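(* Let $G$ be a nontrivial connected compact abelian group. Then $\lambda(G)=\lambda(\mathbb{T})$, where $\mathbb{T}=\mathbb{R}/\mathbb{Z}$.
   Context: For a compact abelian group $G$ with normalized Haar measure $\mu$ and (multiplicative) dual group of characters $\widehat{G}$, let $\mathbb{Z}[\widehat{G}]$ denote the ring of integral linear combinations of characters, regarded as functions on $G$. For $f\in\mathbb{Z}[\widehat{G}]$, the logarithmic Mahler measure over $G$ is $\mathsf{m}_G(f)=\int_G\log|f|\,d\mu$ (with $\log 0=-\infty$, so this may equal $-\infty$). The Lehmer constant of $G$ is $\lambda(G)=\inf\{\mathsf{m}_G(f): f\in\mathbb{Z}[\widehat{G}],\ \mathsf{m}_G(f)>0\}$. *)

(* Defs.v *)
From HB Require Import structures.
From mathcomp Require Import all_boot all_algebra.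
From mathcomp Require Import all_classical all_reals all_analysis.
From mathcomp Require Import complex.

Set Implicit Arguments.
Unset Strict Implicit.
Unset Printing Implicit Defensive.

Import GRing.Theory Num.Theory numFieldNormedType.Exports.
Local Open Scope classical_set_scope.
Local Open Scope ring_scope.

Definition gpt (G : topologicalZmodType) : Type := G.
HB.instance Definition _ (G : topologicalZmodType) := Choice.on (gpt G).
HB.instance Definition _ (G : topologicalZmodType) :=
  isPointed.Build (gpt G) (0%R : G).
Definition borelG (G : topologicalZmodType) :=
  @g_sigma_algebraType (gpt G) (@open G).

Definition is_haar (R : realType) (G : topologicalZmodType)
  (mu : {measure set borelG G -> \bar R}) : Prop :=
  mu setT = 1%E /\
  forall (g : G) (A : set (borelG G)), measurable A ->
    mu ((fun x : G => g + x) @^-1` A) = mu A.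

Definition cmod (R : realType) (z : R[i]) : R := ComplexField.Normc.normc z.

Definition is_character (R : realType) (G : topologicalZmodType)
  (chi : G -> R[i]) : Prop :=
  [/\ forall x y : G, chi (x + y) = chi x * chi y,
      forall x : G, cmod (chi x) = 1,
      continuous (fun x : G => complex.Re (chi x)) &
      continuous (fun x : G => complex.Im (chi x))].

Definition zlin_eval (R : realType) (G : Type) (s : seq (int * (G -> R[i])))
  (x : G) : R[i] :=
  \sum_(p <- s) (p.1)%:~R * p.2 x.

Definition ZGhat (R : realType) (G : topologicalZmodType) : set (G -> R[i]) :=
  [set f | exists s : seq (int * (G -> R[i])),
      (forall p, p \in s -> is_character p.2) /\ f = zlin_eval s].

Definition logabs (R : realType) (z : R[i]) : \bar R :=
  if z == 0 then -oo%E else (ln (cmod z))%:E.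

Definition mahler (R : realType) (G : topologicalZmodType)
  (mu : {measure set borelG G -> \bar R}) (f : G -> R[i]) : \bar R :=
  (\int[mu]_x logabs (f x))%E.

Definition lehmer (R : realType) (G : topologicalZmodType)
  (mu : {measure set borelG G -> \bar R}) : \bar R :=
  ereal_inf [set m | exists2 f, @ZGhat R G f & m = mahler mu f /\ (0 < m)%E].

(* The circle T = R/Z: its characters are t |-> e^{2 pi i n t}, n in Z, so
   Z[T^] consists of the integer Laurent polynomials evaluated at
   e^{2 pi i t}; normalized Haar measure is Lebesgue measure on [0,1]. *)
Definition expi (R : realType) (theta : R) : R[i] :=
  (cos theta +i* sin theta)%C.

Definition laurent_eval (R : realType) (s : seq (int * int)) (t : R) : R[i] :=
  \sum_(p <- s) (p.1)%:~R * expi (2 * pi * (p.2)%:~R * t).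

Definition mahlerT (R : realType) (s : seq (int * int)) : \bar R :=
  (\int[@lebesgue_measure R]_(t in `[0%R, 1%R]) logabs (laurent_eval s t))%E.

Definition lehmerT (R : realType) : \bar R :=
  ereal_inf [set m | exists s : seq (int * int), m = mahlerT R s /\ (0 < m)%E].

(* Main.v *)
(** Upper bound.  A nontrivial connected [G] carries a nontrivial character
    [chi]: for an even continuous [h] of mean zero the normalised convolution
    powers of [h * h] converge uniformly to a convolution idempotent; a minimal
    idempotent, divided by its value at 0, satisfies d'Alembert's equation
    [f (x + a) + f (x - a) = 2 f x f a], so it is the real part of a character.
    Connectedness makes [chi] of infinite order, hence [chi ^ n] and
    [e^{2 pi i n t}] have the same moments, and every Laurent polynomial has the
    same Mahler measure on the circle as its composition with [chi] has on [G].

    Lower bound.  Let [f = sum c_j e_j] with distinct characters [e_j], nonzero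
    integers [c_j] and [0 < m(f)].  Since the relations among the [e_j] form a
    saturated lattice, for each [D] some integers [N_j] satisfy the same
    relations of length [< D], so [|g|^2], with [g = sum c_j chi ^ N_j], has the
    same first [D] moments as [|f|^2].  Hence the means of
    [1/2 ln (|.|^2 + theta ^ J)] for [f] and [g] are close.  They differ from
    [m(f)] and [m(g)] by [O(2 ^ - J)], uniformly over all sums of a given number
    of characters with coefficients of modulus at least 1 (Lawton's estimate,
    proved here by induction on the number of terms with the differences
    [p (x + h) - e_i h * p x]).  So [0 < m(g) <= m(f) + d] for [D] and [J]
    large, and [m(g)] is the Mahler measure of a Laurent polynomial. *)

Require Import Defs.
From HB Require Import structures.
From mathcomp Require Import all_boot all_order all_algebra.
From mathcomp Require Import all_classical all_reals all_analysis.
From mathcomp Require Import complex measurable_realfun ring lra.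
Import Order.TTheory GRing.Theory Num.Theory numFieldNormedType.Exports.

Set Implicit Arguments.
Unset Strict Implicit.
Unset Printing Implicit Defensive.

Local Open Scope classical_set_scope.
Local Open Scope ring_scope.

(** * Means on spaces of continuous functions *)

(** Everything is phrased with means, that is, positive normalised linear functionals on continuous
    functions. Haar integration on [G] and Lebesgue integration on [0, 1] are two instances,
    Fubini's exchange reduces to uniform approximation by finite sums of products, and measure
    theory enters only to build these means and to remove the regularisation of the logarithm. The
    obstacle is the singularity of the logarithm at 0. Moments control only continuous functions of
    [|f|^2], so matching them bounds [m(g)] from above, whereas the infimum ranges over strictly
    positive values and [m(g)] might drop to 0. A lower bound is needed that does not depend on the
    exponents [N_j], since these are chosen only after the regularisation level has been fixed.
    Integrality of the coefficients enters this bound only through [1 <= |c_j|]. The ratio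
    [theta = 4 ^ - a] of consecutive regularisations is dictated by the exponent [a] of the small
    value estimate: it makes the cost of the step from [theta ^ J] to [theta ^ (J + 1)] of order
    [2 ^ - J]. *)

Section ContinuousRealFunctions.
Variables (R : realType) (X : topologicalType).
Implicit Types f g : X -> R.

Lemma cont_cst (c : R) : continuous (fun _ : X => c).
Proof. by move=> x; exact: cvg_cst. Qed.

Lemma contD f g : continuous f -> continuous g -> continuous (fun x => f x + g x).
Proof. by move=> cf cg x; apply: (@cvgD _ R^o); [exact: cf|exact: cg]. Qed.

Lemma contN f : continuous f -> continuous (fun x => - f x).
Proof. by move=> cf x; apply: (@cvgN _ R^o); exact: cf. Qed.

Lemma contB f g : continuous f -> continuous g -> continuous (fun x => f x - g x).
Proof. by move=> cf cg; exact: contD (contN cg). Qed.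

Lemma contM f g : continuous f -> continuous g -> continuous (fun x => f x * g x).
Proof. by move=> cf cg x; apply: (@cvgM R); [exact: cf|exact: cg]. Qed.

Lemma contZ (c : R) f : continuous f -> continuous (fun x => c * f x).
Proof. by move=> cf; apply: contM => //; exact: cont_cst. Qed.

Lemma contX f n : continuous f -> continuous (fun x => f x ^+ n).
Proof.
move=> cf; elim: n => [|n IH]; first exact: cont_cst.
by under eq_fun do rewrite exprS; exact: contM.
Qed.

Lemma contV f : (forall x, f x != 0) -> continuous f -> continuous (fun x => (f x)^-1).
Proof. by move=> f0 cf x; apply: continuousV => //; exact: cf. Qed.

Lemma cont_ln f : (forall x, 0 < f x) -> continuous f -> continuous (fun x => ln (f x)).
Proof.
move=> f0 cf x; apply: (@continuous_comp _ _ _ f (@ln R)); first exact: cf.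
exact: continuous_ln.
Qed.

Lemma cont_sum (J : Type) (s : seq J) (P : pred J) (F : J -> X -> R) :
  (forall j, continuous (F j)) -> continuous (fun x => \sum_(j <- s | P j) F j x).
Proof.
move=> cF; elim: s => [|a s IH].
  by under eq_fun do rewrite big_nil; exact: cont_cst.
by case Pa : (P a); under eq_fun do rewrite big_cons Pa; [exact: contD|].
Qed.

Lemma cont_comp (Y : topologicalType) (h : Y -> X) f :
  continuous h -> continuous f -> continuous (fun y => f (h y)).
Proof. by move=> ch cf y; apply: continuous_comp; [exact: ch|exact: cf]. Qed.

Lemma cont_epsP f : continuous f <->
  forall x (e : R), 0 < e -> \forall y \near x, `|f y - f x| < e.
Proof.
split=> [cf x e e0|H x].
  by have /(@cvgr_distC_lt _ R^o)/(_ e e0) := cf x.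
by apply/(@cvgrPdist_lt _ R^o) => e e0; near=> y; rewrite distrC; near: y; exact: H.
Unshelve. all: by end_near. Qed.

Lemma cont_unif_limit (F : nat -> X -> R) f : (forall n, continuous (F n)) ->
  (forall e : R, 0 < e -> exists n, forall x, `|F n x - f x| <= e) ->
  continuous f.
Proof.
move=> cF lim; apply/cont_epsP => x e e0.
have e40 : 0 < e / 4 by rewrite divr_gt0.
have [n Hn] := lim _ e40.
have /cont_epsP/(_ x _ e40) := cF n; apply: filterS => y Hy.
have Hx' := Hn x; have Hy' := Hn y.
move: Hx' Hy' Hy; rewrite !ler_distl !ltr_distl => /andP[a1 a2] /andP[b1 b2] /andP[c1 c2].
by apply/andP; split; lra.
Qed.

End ContinuousRealFunctions.

Section Mean.
Variables (R : realType) (X : topologicalType).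
Implicit Types (f g : X -> R) (M : (X -> R) -> R).

(** The axioms constrain [M] on continuous functions only; elsewhere the total function [M] is
    arbitrary, hence the continuity side conditions throughout. *)
Definition is_mean M :=
  [/\ forall a f g, continuous f -> continuous g ->
        M (fun x => a * f x + g x) = a * M f + M g,
      forall f, continuous f -> (forall x, 0 <= f x) -> 0 <= M f &
      M (fun=> 1) = 1].

Variable M : (X -> R) -> R.
Hypothesis meanM : is_mean M.

Lemma mean_lin a f g : continuous f -> continuous g ->
  M (fun x => a * f x + g x) = a * M f + M g.
Proof. by case: meanM => H _ _; exact: H. Qed.

Lemma mean_ge0 f : continuous f -> (forall x, 0 <= f x) -> 0 <= M f.
Proof. by case: meanM => _ H _; exact: H. Qed.

Lemma mean0 : M (fun=> 0) = 0.
Proof.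
have := @mean_lin 1 (fun=> 0) (fun=> 0) (@cont_cst R X 0) (@cont_cst R X 0).
have -> : (fun _ : X => 1 * 0 + 0 : R) = (fun=> 0) by apply/funext => x; ring.
by lra.
Qed.

Lemma meanZ a f : continuous f -> M (fun x => a * f x) = a * M f.
Proof.
move=> cf; have := mean_lin a cf (@cont_cst R X 0); rewrite mean0 addr0 => <-.
by congr (M _); apply/funext => x; rewrite addr0.
Qed.

Lemma meanD f g : continuous f -> continuous g ->
  M (fun x => f x + g x) = M f + M g.
Proof.
move=> cf cg; have := mean_lin 1 cf cg; rewrite mul1r => <-.
by congr (M _); apply/funext => x; rewrite mul1r.
Qed.

Lemma meanN f : continuous f -> M (fun x => - f x) = - M f.
Proof.
move=> cf; have := meanZ (-1) cf; rewrite mulN1r => <-.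
by congr (M _); apply/funext => x; rewrite mulN1r.
Qed.

Lemma meanB f g : continuous f -> continuous g ->
  M (fun x => f x - g x) = M f - M g.
Proof. by move=> cf cg; rewrite meanD ?meanN//; exact: contN. Qed.

Lemma mean_cst a : M (fun=> a) = a.
Proof.
have M1 : M (fun=> 1) = 1 by case: meanM.
rewrite -[RHS]mulr1 -M1 -meanZ; last exact: cont_cst.
by congr (M _); apply/funext => x; rewrite mulr1.
Qed.

Lemma mean_le f g : continuous f -> continuous g ->
  (forall x, f x <= g x) -> M f <= M g.
Proof.
move=> cf cg fg; rewrite -subr_ge0 -meanB//; apply: mean_ge0; first exact: contB.
by move=> x; rewrite subr_ge0.
Qed.

Lemma mean_abs_le f c : continuous f -> (forall x, `|f x| <= c) -> `|M f| <= c.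
Proof.
move=> cf H; rewrite ler_norml.
apply/andP; split; [rewrite -[leLHS]mean_cst|rewrite -[leRHS]mean_cst];
  apply: mean_le => //; try exact: cont_cst;
  by move=> x; have := H x; rewrite ler_norml => /andP[].
Qed.

Lemma mean_sum (J : Type) (s : seq J) (P : pred J) (F : J -> X -> R) :
  (forall j, continuous (F j)) ->
  M (fun x => \sum_(j <- s | P j) F j x) = \sum_(j <- s | P j) M (F j).
Proof.
move=> cF; elim: s => [|a s IH].
  by under eq_fun do rewrite big_nil; rewrite mean0 big_nil.
rewrite big_cons; case Pa : (P a); under eq_fun do rewrite big_cons Pa; last by [].
by rewrite meanD ?IH//; exact: cont_sum.
Qed.

Lemma mean_close f g c : continuous f -> continuous g ->
  (forall x, `|f x - g x| <= c) -> `|M f - M g| <= c.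
Proof. by move=> cf cg H; rewrite -meanB//; apply: mean_abs_le => //; exact: contB. Qed.

Lemma mean_CS f g : continuous f -> continuous g ->
  M (fun x => f x * g x) ^+ 2 <= M (fun x => f x ^+ 2) * M (fun x => g x ^+ 2).
Proof.
move=> cf cg; set a := M (fun x => g x ^+ 2); set b := M (fun x => f x * g x).
set c := M (fun x => f x ^+ 2).
have cf2 : continuous (fun x => f x ^+ 2) by exact: contX.
have cg2 : continuous (fun x => g x ^+ 2) by exact: contX.
have cfg := contM cf cg.
have a0 : 0 <= a by apply: mean_ge0 => // x; exact: sqr_ge0.
have c0 : 0 <= c by apply: mean_ge0 => // x; exact: sqr_ge0.
have H s t : 0 <= s ^+ 2 * c + (2 * s * t * b + t ^+ 2 * a).
  rewrite -meanZ// -meanZ// -(meanZ (t ^+ 2))// -meanD//; try exact: contZ.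
  rewrite -meanD; [|exact: contZ|by apply: contD; exact: contZ].
  apply: mean_ge0; first by apply: contD; [exact: contZ|apply: contD; exact: contZ].
  move=> x; have -> : s ^+ 2 * f x ^+ 2 + (2 * s * t * (f x * g x) + t ^+ 2 * g x ^+ 2)
    = (s * f x + t * g x) ^+ 2 by ring.
  exact: sqr_ge0.
have [a_eq0|a_neq0] := eqVneq a 0.
  have [-> |bn0] := eqVneq b 0; first by rewrite a_eq0 mulr0 expr0n.
  (* For [a = 0] the form is affine in [t]; this [t] gives it the value -1. *)
  have := H 1 (- (c + 1) / (2 * b)); rewrite a_eq0.
  have -> : 1 ^+ 2 * c + (2 * 1 * (- (c + 1) / (2 * b)) * b +
    (- (c + 1) / (2 * b)) ^+ 2 * 0) = -1 :> R by field.
  by rewrite ler0N1.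
have agt0 : 0 < a by rewrite lt_neqAle eq_sym a_neq0.
have := H a (- b).
have -> : a ^+ 2 * c + (2 * a * (- b) * b + (- b) ^+ 2 * a) = a * (c * a - b ^+ 2) by ring.
by rewrite pmulr_rge0// subr_ge0.
Qed.

End Mean.

(** * Invariant means on compact abelian groups *)

Section CompactGroup.
Variables (R : realType) (G : topologicalZmodType).
Hypothesis compG : compact [set: G].

Lemma cont_pair (X : topologicalType) (h k : X -> G) :
  continuous h -> continuous k -> continuous (fun x => (h x, k x)).
Proof. by move=> ch ck x; apply: cvg_pair; [exact: ch|exact: ck]. Qed.

Lemma contGD (X : topologicalType) (h k : X -> G) :
  continuous h -> continuous k -> continuous (fun x => h x + k x).
Proof.
move=> ch ck x; apply: (@continuous_comp _ _ _ (fun x => (h x, k x)) (fun p => p.1 + p.2)).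
  exact: cont_pair.
exact: add_continuous.
Qed.

Lemma contGN (X : topologicalType) (h : X -> G) :
  continuous h -> continuous (fun x => - h x).
Proof. by move=> ch x; apply: continuous_comp; [exact: ch|exact: opp_continuous]. Qed.

Lemma contGB (X : topologicalType) (h k : X -> G) :
  continuous h -> continuous k -> continuous (fun x => h x - k x).
Proof. by move=> ch ck; apply: contGD => //; exact: contGN. Qed.

Lemma contG_id : continuous (id : G -> G).
Proof. by move=> x; exact: cvg_id. Qed.

Lemma contG_cst (X : topologicalType) (a : G) : continuous (fun _ : X => a).
Proof. by move=> x; exact: cvg_cst. Qed.

Lemma cont_fst (X Y : topologicalType) : continuous (@fst X Y).
Proof. by move=> x; exact: cvg_fst. Qed.

Lemma cont_snd (X Y : topologicalType) : continuous (@snd X Y).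
Proof. by move=> x; exact: cvg_snd. Qed.

Lemma cont_bounded (f : G -> R) : continuous f -> exists2 c, 0 < c & forall x, `|f x| <= c.
Proof.
move=> cf.
have /compact_near_coveringP H := compG.
have [c [_ /= Hc]] : \forall c \near +oo, forall x, `|f x| <= c.
  have : \forall c \near +oo, [set: G] `<=` (fun x => `|f x| <= c).
    apply: H => x _.
    have := (cont_epsP f).1 cf x 1 ltr01 => Hx.
    near=> x' c => /=.
    have h1 : `|f x' - f x| < 1 by near: x'.
    have h2 : `|f x| + 1 <= c by near: c; exact: nbhs_pinfty_ge.
    by have := ler_normD (f x' - f x) (f x); rewrite subrK; lra.
  by apply: filterS => c Hc x; exact: Hc.
exists (Num.max (c + 1) 1); first by rewrite lt_max ltr01 orbT.
by move=> x; apply: Hc; rewrite lt_max ltrDl ltr01.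
Unshelve. all: by end_near. Qed.

(** The tube lemma: compactness of the second factor makes continuity in the first one uniform. *)
Lemma near_unif (Y : topologicalType) (F : Y -> G -> R) :
  continuous (fun p : Y * G => F p.1 p.2) ->
  forall y (e : R), 0 < e -> \forall y' \near y, forall x, `|F y' x - F y x| < e.
Proof.
move=> cF y e e0.
have /compact_near_coveringP H := compG.
have : \forall y' \near y, [set: G] `<=` (fun x => `|F y' x - F y x| < e).
  apply: H => x _.
  have e20 : 0 < e / 2 by rewrite divr_gt0.
  have := (cont_epsP _).1 cF (y, x) _ e20 => -[[A B] [/= nA nB] AB].
  near=> x' y' => /=.
  have h1 : `|F y' x' - F y x| < e / 2.
    by apply: (AB (y', x')); split => /=; [near: y'; exact: nA|near: x'; exact: nB].
  have h2 : `|F y x' - F y x| < e / 2.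
    by apply: (AB (y, x')); split => /=; [exact: nbhs_singleton|near: x'; exact: nB].
  move: h1 h2; rewrite !ltr_distl => /andP[a1 a2] /andP[b1 b2].
  by apply/andP; split; lra.
by apply: filterS => c Hc x; exact: Hc.
Unshelve. all: by end_near. Qed.

Lemma cont_section (Y : topologicalType) (F : Y -> G -> R) (y : Y) :
  continuous (fun p : Y * G => F p.1 p.2) -> continuous (F y).
Proof.
move=> cF; apply: (@cont_comp _ _ _ (fun x => (y, x)) _ _ cF).
by move=> x; apply: cvg_pair; [exact: cvg_cst|exact: cvg_id].
Qed.

Lemma cont_section1 (Y : topologicalType) (F : Y -> G -> R) (x : G) :
  continuous (fun p : Y * G => F p.1 p.2) -> continuous (fun y => F y x).
Proof.
move=> cF; apply: (@cont_comp _ _ _ (fun y => (y, x)) _ _ cF).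
by move=> y; apply: cvg_pair; [exact: cvg_id|exact: cvg_cst].
Qed.

Hypothesis hausG : hausdorff_space G.

(** Urysohn's lemma, as a compact Hausdorff space is normal and hence completely regular. *)
Lemma separating_function (x : G) (V : set G) : nbhs x V ->
  exists u : G -> R, [/\ continuous u, forall y, 0 <= u y, u x = 1 &
    forall y, ~ V y -> u y = 0].
Proof.
move=> nV.
have CR : completely_regular_space G.
  by apply: (@normal_completely_regular R); [exact: compact_normal|exact: hausdorff_accessible].
have cl : closed (~` V^°) by apply: open_closedC; exact: open_interior.
have nx : ~ (~` V^°) x by move=> /(_ nV).
have /(uniform_separatorP (R:=R))[f [cf f01 fx fV]] := CR x _ cl nx.
exists (fun y => 1 - f y); split.
- by apply: contB => //; exact: cont_cst.
- move=> y; have /andP[_ ?] : 0 <= f y <= 1.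
    by have := f01 (f y); rewrite /= in_itv/=; apply; exists y.
  by rewrite subr_ge0.
- have -> : f x = 0 by apply: fx; exists x.
  by rewrite subr0.
- move=> y Vy; have -> : f y = 1; last by rewrite subrr.
  by apply: fV; exists y => //= /interior_subset.
Qed.

Lemma finite_translates (u : G -> R) : continuous u -> (forall y, 0 <= u y) ->
  (exists x, 0 < u x) ->
  exists s : seq G, forall x, 0 < \sum_(a <- s) u (x - a).
Proof.
move=> cu u0 [x0 ux0].
have /compact_near_coveringP H := compG.
(* Along the filter of finite lists ordered by inclusion, a finite subcover becomes an eventual
   property, as the near-covering form of compactness requires. *)
pose F : set_system (seq G) :=
  filter_from setT (fun s : seq G => [set s' : seq G | {subset s <= s'}]).
have FF : Filter F.
  apply: filter_from_filter; first by exists [::].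
  move=> s t _ _; exists (s ++ t) => // s' /= st.
  by split=> a ain; apply: st; rewrite mem_cat ain ?orbT.
have cua a : continuous (fun x => u (x - a)).
  by apply: cont_comp => //; apply: contGB; [exact: contG_id|exact: contG_cst].
have : \forall s \near F, [set: G] `<=` (fun x => 0 < \sum_(a <- s) u (x - a)).
  apply: H => x _; pose a := x - x0.
  have ua : 0 < u (x - a) by rewrite /a opprB addrCA subrr addr0.
  have := (cont_epsP _).1 (cua a) x _ ua => Hx.
  exists ([set y | 0 < u (y - a)], [set s : seq G | a \in s]) => /=.
    split; last by exists [:: a] => // s /=; apply; rewrite mem_head.
    by apply: filterS Hx => y; rewrite ltr_distl subrr => /andP[].
  move=> [y s] /= [uy ins]; rewrite (big_rem a)//=; apply: ltr_pwDl => //.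
  by apply: sumr_ge0 => i _.
case=> s _ /= Hs; exists s => x.
by apply: (Hs s).
Qed.

Variable M : (G -> R) -> R.
Hypothesis meanM : is_mean M.

Lemma cont_mean (Y : topologicalType) (F : Y -> G -> R) :
  continuous (fun p : Y * G => F p.1 p.2) -> continuous (fun y => M (F y)).
Proof.
move=> cF; apply/cont_epsP => y e e0.
have e20 : 0 < e / 2 by rewrite divr_gt0.
have := near_unif cF y e20; apply: filterS => y' H.
apply: (@le_lt_trans _ _ (e / 2)); last by lra.
apply: mean_close => //; try exact: cont_section.
by move=> x; exact/ltW.
Qed.

Lemma cont_swap (F : G -> G -> R) :
  continuous (fun p : G * G => F p.1 p.2) -> continuous (fun p : G * G => F p.2 p.1).
Proof.
move=> cF; apply: (@cont_comp _ _ _ (fun p : G * G => (p.2, p.1)) _ _ cF).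
by apply: cont_pair; [exact: cont_snd|exact: cont_fst].
Qed.

(** Translates of a bump function, divided by their sum, form a partition of unity [phi a]. On the
    support of [phi a], [F x y] is within [e] of [F a y], so [F] is uniformly close to a finite sum
    of products [phi a x * F a y], for which the exchange is plain linearity. *)
Lemma mean_fubini (F : G -> G -> R) : continuous (fun p : G * G => F p.1 p.2) ->
  M (fun x => M (fun y => F x y)) = M (fun y => M (fun x => F x y)).
Proof.
move=> cF.
suff H (e : R) : 0 < e ->
    `|M (fun x => M (fun y => F x y)) - M (fun y => M (fun x => F x y))| <= e + e.
  apply/eqP; rewrite -subr_eq0 -normr_le0; apply/ler_addgt0Pr => e e0.
  by rewrite add0r; have := H (e / 2); rewrite -splitr; apply; rewrite divr_gt0.
move=> e0.
pose V := [set v : G | forall p : G * G, `|F (p.1 + v) p.2 - F p.1 p.2| < e].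
have nV : nbhs 0 V.
  have /compact_near_coveringP H := compG.
  have : \forall v \near (0 : G), [set: G] `<=` (fun x => forall y, `|F (x + v) y - F x y| < e).
    apply: H => x _.
    have cD : continuous (fun p : (G * G) * G => F (p.1.1 + p.1.2) p.2 - F p.1.1 p.2).
      have c1 : continuous (fun p : (G * G) * G => p.1.1).
        by move=> z; apply: continuous_comp; [exact: cont_fst|exact: cont_fst].
      have c2 : continuous (fun p : (G * G) * G => p.1.2).
        by move=> z; apply: continuous_comp; [exact: cont_fst|exact: cont_snd].
      apply: contB.
        apply: (@cont_comp _ _ _ (fun p : (G * G) * G => (p.1.1 + p.1.2, p.2)) _ _ cF).
        by apply: cont_pair; [exact: contGD|exact: cont_snd].
      apply: (@cont_comp _ _ _ (fun p : (G * G) * G => (p.1.1, p.2)) _ _ cF).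
      by apply: cont_pair; [|exact: cont_snd].
    have := near_unif (F := fun (q : G * G) y => F (q.1 + q.2) y - F q.1 y) cD (x, 0) e0.
    apply: filterS => -[x' v] /= Hv y.
    by have := Hv y; rewrite addr0 subrr subr0.
  by apply: filterS => v Hv [x y] /=; exact: Hv.
have [u [cu u0 u1 uV]] := separating_function nV.
have [|s Hs] := finite_translates cu u0; first by exists 0; rewrite u1.
pose S x := \sum_(a <- s) u (x - a).
have cua a : continuous (fun x => u (x - a)).
  by apply: cont_comp => //; apply: contGB; [exact: contG_id|exact: contG_cst].
have cS : continuous S by exact: cont_sum.
pose phi a x := u (x - a) / S x.
have Sn0 x : S x != 0 by rewrite gt_eqF//; exact: Hs.
have cphi a : continuous (phi a) by apply: contM => //; exact: contV.
have cFa a : continuous (F a) by exact: cont_section.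
pose K x y := \sum_(a <- s) phi a x * F a y.
have HK x y : `|F x y - K x y| <= e.
  have -> : F x y - K x y = \sum_(a <- s) phi a x * (F x y - F a y).
    under [RHS]eq_bigr do rewrite mulrBr.
    rewrite big_split/= sumrN -mulr_suml; congr (_ - _).
    by rewrite /phi -mulr_suml -/(S x) divff// mul1r.
  apply: (le_trans (ler_norm_sum _ _ _)).
  have -> : e = \sum_(a <- s) phi a x * e.
    by rewrite -mulr_suml /phi -mulr_suml -/(S x) divff// mul1r.
  apply: ler_sum => a _; rewrite normrM ger0_norm; last first.
    by rewrite divr_ge0//; exact/ltW/Hs.
  have [Va|nVa] := pselect (V (x - a)); last by rewrite /phi uV// !mul0r.
  rewrite ler_wpM2l//; first by rewrite divr_ge0//; exact/ltW/Hs.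
  by have := Va (a, y); rewrite /= (addrCA a x) subrr addr0 => /ltW.
have MMK : M (fun x => M (fun y => K x y)) = \sum_(a <- s) M (phi a) * M (F a).
  have -> : (fun x => M (fun y => K x y)) = (fun x => \sum_(a <- s) M (F a) * phi a x).
    apply/funext => x; rewrite mean_sum//; last by move=> a; exact: contZ.
    by apply: eq_bigr => a _; rewrite meanZ// mulrC.
  rewrite mean_sum//; last by move=> a; exact: contZ.
  by apply: eq_bigr => a _; rewrite meanZ// mulrC.
have MMK' : M (fun y => M (fun x => K x y)) = \sum_(a <- s) M (phi a) * M (F a).
  have -> : (fun y => M (fun x => K x y)) = (fun y => \sum_(a <- s) M (phi a) * F a y).
    apply/funext => y.
    have -> : (fun x => K x y) = (fun x => \sum_(a <- s) F a y * phi a x).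
      by apply/funext => x; apply: eq_bigr => a _; rewrite mulrC.
    rewrite mean_sum//; last by move=> a; exact: contZ.
    by apply: eq_bigr => a _; rewrite meanZ// mulrC.
  rewrite mean_sum//; last by move=> a; exact: contZ.
  by apply: eq_bigr => a _; rewrite meanZ.
have cK : continuous (fun p : G * G => K p.1 p.2).
  apply: cont_sum => a; apply: contM.
    by apply: (@cont_comp _ _ _ fst _ _ (cphi a)); exact: cont_fst.
  by apply: (@cont_comp _ _ _ snd _ _ (cFa a)); exact: cont_snd.
have h1 : `|M (fun x => M (F x)) - M (fun x => M (K x))| <= e.
  apply: mean_close => //; [exact: cont_mean|exact: cont_mean|].
  by move=> x; apply: mean_close => //; exact: cont_section.
have h2 : `|M (fun y => M (fun x => F x y)) - M (fun y => M (fun x => K x y))| <= e.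
  apply: mean_close => //.
  - by apply: (@cont_mean _ (fun y x => F x y)); exact: cont_swap.
  - by apply: (@cont_mean _ (fun y x => K x y)); exact: cont_swap.
  by move=> y; apply: mean_close => //; apply: cont_section1.
move: h1 h2; rewrite MMK MMK' !ler_distl => /andP[a1 a2] /andP[b1 b2].
by apply/andP; split; lra.
Qed.

Hypothesis invM : forall (a : G) f, continuous f -> M (fun x => f (a + x)) = M f.

(** Both iterated means of [f (y - x)] are computed by invariance: one is [M f], the other the mean
    of the reflected function. *)
Lemma mean_inv (f : G -> R) : continuous f -> M (fun x => f (- x)) = M f.
Proof.
move=> cf.
have cn : continuous (fun x : G => f (- x)).
  by apply: cont_comp => //; apply: contGN; exact: contG_id.
have cF : continuous (fun p : G * G => f (p.2 - p.1)).
  by apply: cont_comp => //; apply: contGB; [exact: cont_snd|exact: cont_fst].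
have := mean_fubini (F := fun x y => f (y - x)) cF.
have -> : (fun x => M (fun y => f (y - x))) = (fun=> M f).
  apply/funext => x; under eq_fun do rewrite addrC; exact: invM.
have -> : (fun y => M (fun x => f (y - x))) = (fun=> M (fun x => f (- x))).
  apply/funext => y.
  have := @invM (- y) (fun x => f (- x)) cn => <-.
  by congr (M _); apply/funext => x; rewrite opprD opprK.
by rewrite !mean_cst.
Qed.

Lemma mean_refl (a : G) (f : G -> R) : continuous f -> M (fun x => f (a - x)) = M f.
Proof.
move=> cf; have cg : continuous (fun x => f (a + x)).
  by apply: cont_comp => //; apply: contGD; [exact: contG_cst|exact: contG_id].
by rewrite (mean_inv cg) invM.
Qed.

(** A finite sum of translates of [f] is positive on a compact space, hence bounded below by a
    positive constant, and its mean is a multiple of [M f]. *)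
Lemma mean_gt0 (f : G -> R) : continuous f -> (forall x, 0 <= f x) ->
  (exists x, 0 < f x) -> 0 < M f.
Proof.
move=> cf f0 fx; have [s Hs] := finite_translates cf f0 fx.
have cfa a : continuous (fun x => f (x - a)).
  by apply: cont_comp => //; apply: contGB; [exact: contG_id|exact: contG_cst].
pose S x := \sum_(a <- s) f (x - a).
have cS : continuous S by exact: cont_sum.
have cV : continuous (fun x => (S x)^-1) by apply: contV => // x; rewrite gt_eqF//; exact: Hs.
have [c c0 Hc] := cont_bounded cV.
have MS : M S = (size s)%:R * M f.
  rewrite mean_sum//; under eq_bigr => a _.
    under eq_fun do rewrite addrC; rewrite invM//; over.
  by rewrite big_const_seq count_predT iter_addr_0 mulr_natl.
have cMS : c^-1 <= M S.
  rewrite -[leLHS](mean_cst meanM); apply: mean_le => //; first exact: cont_cst.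
  move=> x; have := Hc x; rewrite ger0_norm ?invr_ge0; last exact/ltW/Hs.
  by move=> H; rewrite -[leRHS]invrK lef_pV2 ?posrE ?invr_gt0//; exact: Hs.
rewrite lt_neqAle mean_ge0// andbT; apply/eqP => M0.
by move: cMS; rewrite MS -M0 mulr0 leNgt invr_gt0 c0.
Qed.

End CompactGroup.

(** * Existence of a nontrivial character *)

Section RealSequences.
Variable R : realType.

Lemma unif_cauchy_limit (X : Type) (F : nat -> X -> R) :
  (forall e, 0 < e -> exists N, forall n m, (N <= n)%N -> (N <= m)%N ->
     forall x, `|F n x - F m x| <= e) ->
  exists f, forall e, 0 < e -> exists N, forall n, (N <= n)%N ->
     forall x, `|F n x - f x| <= e.
Proof.
move=> H.
have cF x : cvgn (fun n => F n x : R^o).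
  apply/cauchy_cvgP/cauchy_ballP => e e0.
  have e20 : 0 < e / 2 by rewrite divr_gt0.
  have [N HN] := H _ e20.
  near_simpl; near=> n m => /=; rewrite -ball_normE /=.
  apply: (@le_lt_trans _ _ (e / 2)); last by lra.
  by apply: HN; [near: n|near: m]; exact: nbhs_infty_ge.
exists (fun x => limn (fun n => F n x : R^o)) => e e0.
have [N HN] := H _ e0; exists N => n Nn x.
have c : (fun m => `|F n x - F m x| : R^o) @ \oo -->
    (`|F n x - limn (fun n => F n x : R^o)| : R^o).
  by apply: cvg_norm; apply: cvgB; [exact: cvg_cst|exact: cF].
rewrite -(cvg_lim _ c)//; apply: limr_le; first by apply/cvg_ex; eexists; exact: c.
by near=> m; apply: HN => //; near: m; exact: nbhs_infty_ge.
Unshelve. all: by end_near. Qed.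

Lemma bernoulli_le (t : R) n : 0 <= t -> t <= 1 -> 1 - n%:R * t <= (1 - t) ^+ n.
Proof.
move=> t0 t1; elim: n => [|n IH]; first by rewrite mul0r subr0 expr0.
rewrite exprS; apply: (@le_trans _ _ ((1 - t) * (1 - n%:R * t))); last first.
  by rewrite ler_wpM2l// subr_ge0.
have -> : (1 - t) * (1 - n%:R * t) = 1 - n.+1%:R * t + n%:R * t ^+ 2.
  by rewrite -natr1; ring.
by rewrite lerDl mulr_ge0// sqr_ge0.
Qed.

(* Submultiplicativity forces [a n >= lam ^ n.+1], so the normalised sequence
   does not decay to 0. *)
Lemma logconvex_submult_limit (a : nat -> R) :
  (forall n, 0 < a n) -> (forall n, a n.+1 ^+ 2 <= a n * a n.+2) ->
  (forall n m, a (n + m).+1 <= a n * a m) ->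
  exists2 lam, 0 < lam & exists2 d, 1 <= d &
    forall e, 0 < e -> exists N, forall n, (N <= n)%N ->
      d <= a n / lam ^+ n.+1 <= d + e.
Proof.
move=> a0 alc asm.
pose r n := a n.+1 / a n.
have r0 n : 0 < r n by rewrite divr_gt0.
have rS n : r n <= r n.+1.
  rewrite /r ler_pdivrMr// mulrAC ler_pdivlMr//.
  by rewrite mulrC; have := alc n; rewrite expr2 mulrC => /le_trans; apply; rewrite mulrC.
have rle n m : (n <= m)%N -> r n <= r m.
  by move=> /subnK <-; elim: (m - n)%N => // k IH; exact: le_trans IH (rS _).
have rb n : r n <= a 0.
  by rewrite /r ler_pdivrMr//; have := asm 0 n; rewrite add0n.
have hs : has_sup (range r).
  by split; [exists (r 0), 0|exists (a 0) => _ [n _ <-]].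
(* Log-convexity makes the ratios [r] nondecreasing and submultiplicativity bounds them, so [lam] is
   their limit. *)
pose lam := sup (range r).
have rlam n : r n <= lam by apply: ub_le_sup; [case: hs|exists n].
have lam0 : 0 < lam by exact: lt_le_trans (r0 0) (rlam 0).
have lamn0 : lam != 0 by rewrite gt_eqF.
exists lam => //.
pose b n := a n / lam ^+ n.+1.
have b0 n : 0 < b n by rewrite divr_gt0// exprn_gt0.
have bS n : b n.+1 = b n * (r n / lam).
  have an0 : a n != 0 by rewrite gt_eqF.
  have ln0 : lam ^+ n.+1 != 0 by rewrite expf_neq0.
  by rewrite /b /r exprSr; field; rewrite lamn0 an0.
have bdec n m : (n <= m)%N -> b m <= b n.
  move=> /subnK <-; elim: (m - n)%N => // k IH; apply: le_trans IH.
  by rewrite addSn bS ler_piMr//; [exact: ltW|rewrite ler_pdivrMr// mul1r].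
have bsm n m : b (n + m).+1 <= b n * b m.
  rewrite /b mulrACA -invfM -exprD addSn addnS.
  by rewrite ler_wpM2r ?asm// invr_ge0 exprn_ge0//; exact: ltW.
have bgrow m j : (r m / lam) ^+ j * b m <= b (j + m)%N.
  elim: j => [|j IH]; first by rewrite expr0 mul1r add0n.
  rewrite addSn bS exprS -mulrA mulrC.
  apply: ler_pM => //; [|exact/ltW/divr_gt0|].
    by apply: mulr_ge0; [apply: exprn_ge0; exact/ltW/divr_gt0|exact: ltW].
  by rewrite ler_pM2r ?invr_gt0//; apply: rle; rewrite leq_addl.
have b1 n : 1 <= b n.
  rewrite leNgt; apply/negP => bn1.
  (* With this [t] Bernoulli's inequality bounds [(1 - t) ^+ n.+1] below by [(1 + b n) / 2], which
     exceeds [b n]. A ratio [r m] above [(1 - t) * lam] yields the opposite inequality, since [b]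
     shrinks from [m] to [m + n + 1] at most by that power and at least by the factor [b n]. *)
  pose t := (1 - b n) / (2 * n.+1%:R).
  have n1 : (1 : R) <= n.+1%:R by rewrite ler1n.
  have t0 : 0 < t by rewrite divr_gt0// ?subr_gt0// mulr_gt0//.
  have tn : n.+1%:R * t = (1 - b n) / 2 by rewrite /t; field; rewrite gt_eqF//; lra.
  have t1 : t <= 1 by have := b0 n; nra.
  have [_ [m _ <-] Hm] : exists2 x, range r x & lam - t * lam < x.
    by apply: sup_adherent => //; rewrite mulr_gt0.
  have : (1 - t) ^+ n.+1 <= b n.
    have h1 : (r m / lam) ^+ n.+1 * b m <= b n * b m.
      by apply: le_trans (bgrow m n.+1) _; rewrite addSn.
    rewrite ler_pM2r// in h1; apply: le_trans h1.
    apply: lerXn2r; rewrite ?nnegrE ?subr_ge0//; first exact/ltW/divr_gt0.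
    by apply: ltW; rewrite ltr_pdivlMr// mulrBl mul1r.
  by have := bernoulli_le n.+1 (ltW t0) t1; rewrite tn; have := b0 n; lra.
have hi : has_inf (range b).
  by split; [exists (b 0), 0|exists 1 => _ [n _ <-]].
exists (inf (range b)); first by apply: lb_le_inf => [|_ [n _ <-]//]; case: hi.
move=> e e0; have [_ [N _ <-] HN] := inf_adherent e0 hi.
exists N => n Nn; rewrite -/(b n); apply/andP; split.
  by apply: ge_inf; [case: hi|exists n].
exact: le_trans (bdec _ _ Nn) (ltW HN).
Qed.

End RealSequences.

(** * Convolution with respect to an invariant mean *)

Section Convolution.
Variables (R : realType) (G : topologicalZmodType).
Variable M : (G -> R) -> R.
Implicit Types f g h : G -> R.

Definition convol (f g : G -> R) : G -> R := fun x => M (fun y => f (x - y) * g y).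

(** For real functions, evenness is self-adjointness of the convolution operator; it makes
    [convol f g 0] the inner product of [f] and [g]. *)
Definition even_cont (f : G -> R) : Prop := continuous f /\ forall x, f (- x) = f x.

Hypothesis compG : compact [set: G].
Hypothesis hausG : hausdorff_space G.
Hypothesis meanM : is_mean M.
Hypothesis invM : forall (a : G) f, continuous f -> M (fun x => f (a + x)) = M f.

Let fubini := mean_fubini compG hausG meanM.
Let minv := mean_inv compG hausG meanM invM.
Let mrefl := mean_refl compG hausG meanM invM.
Let mgt0 := mean_gt0 compG meanM invM.

Lemma cont_sub2 (f : G -> R) : continuous f -> continuous (fun p : G * G => f (p.1 - p.2)).
Proof.
by move=> cf; apply: cont_comp => //; apply: contGB; [exact: cont_fst|exact: cont_snd].
Qed.

Lemma cont_on1 (X : topologicalType) (f : G -> R) :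
  continuous f -> continuous (fun p : G * X => f p.1).
Proof. by move=> cf; apply: cont_comp => //; exact: cont_fst. Qed.

Lemma cont_on2 (X : topologicalType) (f : G -> R) :
  continuous f -> continuous (fun p : X * G => f p.2).
Proof. by move=> cf; apply: cont_comp => //; exact: cont_snd. Qed.

Lemma cont_shift (f : G -> R) a : continuous f -> continuous (fun x => f (x + a)).
Proof.
by move=> cf; apply: cont_comp => //; apply: contGD; [exact: contG_id|exact: contG_cst].
Qed.

Lemma cont_refl (f : G -> R) a : continuous f -> continuous (fun x => f (a - x)).
Proof.
by move=> cf; apply: cont_comp => //; apply: contGB; [exact: contG_cst|exact: contG_id].
Qed.

Lemma mean_shift (f : G -> R) a : continuous f -> M (fun x => f (x + a)) = M f.
Proof. by move=> cf; under eq_fun do rewrite addrC; exact: invM. Qed.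

Lemma cont_convolF f g : continuous f -> continuous g ->
  continuous (fun p : G * G => f (p.1 - p.2) * g p.2).
Proof. by move=> cf cg; apply: contM; [exact: cont_sub2|exact: cont_on2]. Qed.

Lemma cont_convol f g : continuous f -> continuous g -> continuous (convol f g).
Proof.
move=> cf cg; apply: (@cont_mean _ _ compG _ meanM G (fun x y => f (x - y) * g y)).
exact: cont_convolF.
Qed.

Lemma convolC f g : continuous f -> continuous g -> convol f g = convol g f.
Proof.
move=> cf cg; apply/funext => x; rewrite /convol.
have cF : continuous (fun y => f (x - y) * g y) by apply: contM => //; exact: cont_refl.
rewrite -(mrefl x cF); congr (M _); apply/funext => y.
by rewrite opprB addrCA subrr addr0 mulrC.
Qed.

Lemma convolDl a f g h : continuous f -> continuous g -> continuous h ->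
  convol (fun x => a * f x + g x) h = (fun x => a * convol f h x + convol g h x).
Proof.
move=> cf cg ch; apply/funext => x; rewrite /convol -mean_lin//.
- by congr (M _); apply/funext => y; ring.
- by apply: contM => //; exact: cont_refl.
- by apply: contM => //; exact: cont_refl.
Qed.

Lemma convolDr a f g h : continuous f -> continuous g -> continuous h ->
  convol h (fun x => a * f x + g x) = (fun x => a * convol h f x + convol h g x).
Proof.
move=> cf cg ch; rewrite convolC ?convolDl//; last by apply: contD => //; exact: contZ.
by rewrite (convolC ch cf) (convolC ch cg).
Qed.

Lemma convolZl a f h : continuous f -> continuous h ->
  convol (fun x => a * f x) h = (fun x => a * convol f h x).
Proof.
move=> cf ch; apply/funext => x; rewrite /convol -meanZ//; last first.
  by apply: contM => //; exact: cont_refl.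
by congr (M _); apply/funext => y; ring.
Qed.

Lemma convolZr a f h : continuous f -> continuous h ->
  convol h (fun x => a * f x) = (fun x => a * convol h f x).
Proof.
by move=> cf ch; rewrite convolC ?convolZl//; [rewrite (convolC cf ch)|exact: contZ].
Qed.

Lemma convolBr f g h : continuous f -> continuous g -> continuous h ->
  convol h (fun x => f x - g x) = (fun x => convol h f x - convol h g x).
Proof.
move=> cf cg ch.
have -> : (fun x => f x - g x) = (fun x => (-1) * g x + f x).
  by apply/funext => x; ring.
by rewrite convolDr//; apply/funext => x; ring.
Qed.

Lemma convolA f g h : continuous f -> continuous g -> continuous h ->
  convol (convol f g) h = convol f (convol g h).
Proof.
move=> cf cg ch; apply/funext => x; rewrite /convol.
have cF : continuous (fun p : G * G => f (x - p.2) * g (p.2 - p.1) * h p.1).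
  apply: contM; last exact: cont_on1.
  apply: contM; first by apply: (@cont_on2 G (fun z => f (x - z))); exact: cont_refl.
  by apply: (@cont_swap _ _ (fun a b => g (a - b))); exact: cont_sub2.
transitivity (M (fun y => M (fun z => f (x - z) * g (z - y) * h y))).
  congr (M _); apply/funext => y; rewrite mulrC -meanZ//; last first.
    by apply: contM => //; exact: cont_refl.
  have c1 : continuous (fun z => h y * (f (x - y - z) * g z)).
    by apply: contZ; apply: contM => //; exact: cont_refl.
  rewrite -(mean_shift (- y) c1); congr (M _); apply/funext => z.
  by rewrite -addrA -opprD [y + _]addrC subrK; ring.
rewrite (fubini (F := fun y z => f (x - z) * g (z - y) * h y) cF).
congr (M _); apply/funext => z; rewrite -meanZ//; last first.
  by apply: contM => //; exact: cont_refl.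
by congr (M _); apply/funext => y; ring.
Qed.

Lemma mean_convol f g : continuous f -> continuous g -> M (convol f g) = M f * M g.
Proof.
move=> cf cg; rewrite /convol (fubini (F := fun x y => f (x - y) * g y) (cont_convolF cf cg)).
rewrite -meanZ//; congr (M _); apply/funext => y.
under eq_fun do rewrite mulrC.
by rewrite meanZ ?mean_shift// 1?mulrC//; exact: cont_shift.
Qed.

Lemma even_convol f g : even_cont f -> even_cont g -> even_cont (convol f g).
Proof.
move=> [cf ef] [cg eg]; split; first exact: cont_convol.
move=> x; rewrite /convol.
have cF : continuous (fun y => f (x - y) * g y) by apply: contM => //; exact: cont_refl.
rewrite -(minv cF); congr (M _); apply/funext => y.
by rewrite eg -(ef (- x - y)) opprD !opprK.
Qed.

Lemma even_lin a f g : even_cont f -> even_cont g -> even_cont (fun x => a * f x + g x).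
Proof.
move=> [cf ef] [cg eg]; split; first by apply: contD => //; exact: contZ.
by move=> x; rewrite ef eg.
Qed.

Lemma convol_at0 f g : even_cont f -> convol f g 0 = M (fun y => f y * g y).
Proof. by move=> [cf ef]; congr (M _); apply/funext => y; rewrite sub0r ef. Qed.

Lemma convol_le f g x : continuous f -> continuous g ->
  convol f g x ^+ 2 <= M (fun y => f y ^+ 2) * M (fun y => g y ^+ 2).
Proof.
move=> cf cg; apply: le_trans (mean_CS meanM (cont_refl cf) cg) _.
by rewrite (@mrefl x (fun y => f y ^+ 2))//; exact: contX.
Qed.

Lemma convol_self_le f x : continuous f -> `|convol f f x| <= M (fun y => f y ^+ 2).
Proof.
move=> cf; rewrite -[leRHS]ger0_norm; last first.
  by apply: mean_ge0 => // [|y]; [exact: contX|exact: sqr_ge0].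
by rewrite -[leLHS]ger0_norm// -ler_sqr ?nnegrE// !real_normK ?num_real// expr2 convol_le.
Qed.

Lemma convol_unif f g h c e : continuous f -> continuous g -> continuous h ->
  (forall x, `|f x| <= c) -> (forall x, `|g x - h x| <= e) ->
  forall x, `|convol f g x - convol f h x| <= c * e.
Proof.
move=> cf cg ch fc gh x; apply: mean_close => //.
- by apply: contM => //; exact: cont_refl.
- by apply: contM => //; exact: cont_refl.
by move=> y; rewrite -mulrBr normrM; apply: ler_pM.
Qed.

Lemma mean_sqr_eq0 f : continuous f -> M (fun y => f y ^+ 2) = 0 -> f = (fun=> 0).
Proof.
move=> cf f0; apply/funext => x; apply/eqP; rewrite -[_ == _]negbK; apply/negP => fx.
have : 0 < M (fun y => f y ^+ 2).
  apply: mgt0; [exact: contX|by move=> y; exact: sqr_ge0|].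
  by exists x; rewrite exprn_even_gt0.
by rewrite f0 ltxx.
Qed.

End Convolution.

(** * The projection onto the top eigenspace of a convolution operator *)

Section SpectralIdempotent.
Variables (R : realType) (G : topologicalZmodType).
Variable M : (G -> R) -> R.
Implicit Types f g h P Q : G -> R.
Hypothesis compG : compact [set: G].
Hypothesis hausG : hausdorff_space G.
Hypothesis meanM : is_mean M.
Hypothesis invM : forall (a : G) f, continuous f -> M (fun x => f (a + x)) = M f.

Local Notation convol := (convol M).

Let convolC := convolC compG hausG meanM invM.
Let convolA := convolA compG hausG meanM invM.
Let econvol := even_convol compG hausG meanM invM.
Let convol_at0 := convol_at0 M.
Let sqr_eq0 := mean_sqr_eq0 compG meanM invM.

(** Since no unit for convolution is available, [hpow h n] has [n + 1] factors; hence the successors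
    in the exponent laws. *)
Definition hpow h n := iter n (convol h) h.

Lemma even_hpow n h : even_cont h -> even_cont (hpow h n).
Proof. by move=> eh; elim: n => // n IH; exact: econvol. Qed.
Arguments even_hpow n {h}.

Lemma cont_hpow h n : even_cont h -> continuous (hpow h n).
Proof. by move=> eh; have [] := even_hpow n eh. Qed.

Lemma convol_hpow h n m : even_cont h -> convol (hpow h n) (hpow h m) = hpow h (n + m).+1.
Proof.
move=> eh; have [ch _] := eh; elim: n => // n IH.
by rewrite /= convolA ?IH//; exact: cont_hpow.
Qed.

(** [lam] is the largest eigenvalue of convolution by [convol h h], and [P] is the kernel of the
    orthogonal projection onto its eigenspace. The last clause keeps [P] inside the range of any
    projection [Q] that fixes [h], which the later descent relies on. *)
Lemma spectral_idempotent h : even_cont h -> M (fun x => h x ^+ 2) != 0 ->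
  exists2 lam, 0 < lam & exists P,
    [/\ even_cont P, convol P P = P, 1 <= P 0,
        convol (convol h h) P = (fun x => lam * P x) &
        forall Q, continuous Q -> convol h Q = h -> convol P Q = P].
Proof.
move=> eh hn0; have [ch _] := eh.
have ehn n := even_hpow n eh.
have chn n : continuous (hpow h n) by case: (ehn n).
have csq f : continuous f -> continuous (fun x => f x ^+ 2) by exact: contX.
(* [u n] is the power of [convol h h] with [n + 1] factors. Its value at 0 is a squared norm and
   bounds it everywhere, which gives submultiplicativity; Cauchy-Schwarz gives log-convexity. *)
pose u n := hpow h (n + n).+1.
have uE n : u n = convol (hpow h n) (hpow h n) by rewrite convol_hpow.
have eu n : even_cont (u n) by exact: even_hpow.
have cu n : continuous (u n) by case: (eu n).
have uu n m : convol (u n) (u m) = u (n + m).+1.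
  by rewrite convol_hpow// /u; congr (hpow h _); rewrite !addnS !addSn addnACA.
pose a n := u n 0.
have aE n : a n = M (fun x => hpow h n x ^+ 2).
  by rewrite /a uE convol_at0//; under eq_fun do rewrite -expr2.
have ub n x : `|u n x| <= a n by rewrite aE uE; apply: convol_self_le.
have a_ge0 n : 0 <= a n by exact: le_trans (ub n 0).
have asm n m : a (n + m).+1 <= a n * a m.
  rewrite /a -uu convol_at0//.
  have H x : `|u n x * u m x| <= a n * a m by rewrite normrM ler_pM.
  by have := mean_abs_le meanM (contM (cu n) (cu m)) H; exact/le_trans/ler_norm.
have alc n : a n.+1 ^+ 2 <= a n * a n.+2.
  have -> : a n.+1 = M (fun x => hpow h n x * hpow h n.+2 x).
    by rewrite -convol_at0// convol_hpow// /a /u; congr (hpow h _ 0); rewrite !addnS !addSn.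
  by rewrite !aE; exact: mean_CS.
have a00 : 0 < a 0 by rewrite lt_neqAle a_ge0 andbT eq_sym aE.
have a10 : 0 < a 1.
  rewrite lt_neqAle a_ge0 andbT eq_sym aE; apply/eqP => /(sqr_eq0 (chn 1%N)) H.
  by have := a00; rewrite (_ : a 0 = hpow h 1 0)// H ltxx.
have a0 n : 0 < a n.
  suff [] : 0 < a n /\ 0 < a n.+1 by [].
  elim: n => // n [IH1 IH2]; split => //.
  rewrite -(pmulr_rgt0 _ IH1); apply: lt_le_trans (alc n).
  by rewrite exprn_gt0.
have [lam lam0 [d d1 Hd]] := logconvex_submult_limit a0 alc asm.
exists lam => //; have lamn0 : lam != 0 by rewrite gt_eqF.
pose v n x := (lam ^+ n.+1)^-1 * u n x.
have cv n : continuous (v n) by exact: contZ.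
have vv n m : convol (v n) (v m) = v (n + m).+1.
  rewrite /v convolZl// ?convolZr ?uu//; last exact: contZ.
  apply/funext => x; rewrite -addSn -addnS exprD; field.
  by rewrite !expf_neq0.
pose b n := a n / lam ^+ n.+1.
have v0 n : v n 0 = b n by rewrite /v mulrC.
have ev n : even_cont (v n).
  by split => // x; rewrite /v; have [_ ->] := eu n.
(* Squared distances between the normalised powers involve only the convergent sequence [b], so
   these powers are Cauchy in mean square. *)
have vsq n m : M (fun x => (v n x - v m x) ^+ 2) = b (n + n).+1 - 2 * b (n + m).+1 + b (m + m).+1.
  rewrite -!v0 -!vv !convol_at0// -(meanZ meanM); last exact: contM.
  rewrite -(meanB meanM); [|exact: contM|by apply: contZ; exact: contM].
  rewrite -(meanD meanM); [|by apply: contB; [|apply: contZ]; exact: contM|exact: contM].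
  by congr (M _); apply/funext => x; ring.
pose k := convol h h.
have kE : k = u 0 by [].
have ck : continuous k by rewrite kE.
have kv n : convol k (v n) = (fun x => lam * v n.+1 x).
  rewrite /v convolZr// kE uu add0n; apply/funext => x.
  rewrite (exprS lam n.+1); have := expf_neq0 n.+1 lamn0.
  by move: (lam ^+ n.+1) => L L0; field; rewrite ?lamn0 ?L0.
pose C := M (fun x => k x ^+ 2).
have C0 : 0 <= C by apply: mean_ge0 => // [|x]; [exact: csq|exact: sqr_ge0].
(* One more convolution by [k] upgrades mean square convergence to uniform convergence; this is why
   the index is [n.+1]. All [b] in play lie in an interval of length [t], so the squared distance is
   at most [2 * t]; the [C + 1] in [t] avoids a division by 0. *)
have cauchy e : 0 < e -> exists N, forall n m, (N <= n)%N -> (N <= m)%N ->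
     forall x, `|v n.+1 x - v m.+1 x| <= e.
  move=> e0; pose t := e ^+ 2 * lam ^+ 2 / (2 * (C + 1)).
  have t0 : 0 < t by rewrite divr_gt0 ?mulr_gt0 ?exprn_gt0//; lra.
  have [N HN] := Hd _ t0; exists N => n m Nn Nm x.
  have H : lam * (v n.+1 x - v m.+1 x) = convol k (fun y => v n y - v m y) x.
    by rewrite convolBr// !kv; ring.
  have := convol_le compG hausG meanM invM x ck (contB (cv n) (cv m)).
  rewrite -H vsq -/C => H2.
  have {}H2 : (lam * (v n.+1 x - v m.+1 x)) ^+ 2 <= C * (2 * t).
    apply: le_trans H2 _; rewrite ler_wpM2l//.
    have /andP[? ?] : d <= b (n + n).+1 <= d + t.
      by apply: HN; apply: leq_trans Nn _; rewrite -addnS leq_addr.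
    have /andP[? ?] : d <= b (n + m).+1 <= d + t.
      by apply: HN; apply: leq_trans Nn _; rewrite -addnS leq_addr.
    have /andP[? ?] : d <= b (m + m).+1 <= d + t.
      by apply: HN; apply: leq_trans Nm _; rewrite -addnS leq_addr.
    lra.
  have {}H2 : (v n.+1 x - v m.+1 x) ^+ 2 <= e ^+ 2.
    have l2 : 0 < lam ^+ 2 by rewrite exprn_gt0.
    rewrite -(ler_pM2l l2) -exprMn; apply: le_trans H2 _.
    have -> : C * (2 * t) = lam ^+ 2 * e ^+ 2 * (C / (C + 1)).
      by rewrite /t; field; rewrite gt_eqF//; lra.
    apply: ler_piMr; first by apply: mulr_ge0; exact: sqr_ge0.
    by rewrite ler_pdivrMr ?mul1r ?lerDl//; lra.
  by rewrite -ler_sqr ?nnegrE ?normr_ge0 ?(ltW e0)// real_normK ?num_real.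
have [P HP] := unif_cauchy_limit (F := fun n => v n.+1) cauchy.
have cP : continuous P.
  apply: (@cont_unif_limit _ _ (fun n => v n.+1)) => // e e0.
  by have [N HN] := HP _ e0; exists N => x; exact: HN.
have uniq (c x y : R) : (forall e, 0 < e -> `|x - y| <= c * e) -> x = y.
  move=> H; apply/eqP; rewrite -subr_eq0 -normr_le0; apply/ler_addgt0Pr => e e0.
  rewrite add0r; have c1 : 0 < `|c| + 1 by rewrite ltr_wpDl.
  apply: le_trans (H (e / (`|c| + 1)) _) _; first by rewrite divr_gt0.
  rewrite mulrA ler_pdivrMr// mulrC ler_wpM2l//; first exact: ltW.
  by apply: le_trans (ler_norm _) _; rewrite lerDl.
have eP : even_cont P.
  split => // x; apply: (uniq 2) => e e0; have [N HN] := HP _ e0.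
  have := HN _ (leqnn N) x; have := HN _ (leqnn N) (- x); rewrite (ev N.+1).2.
  rewrite !ler_distl => /andP[? ?] /andP[? ?].
  by apply/andP; split; lra.
have [p p0 Pp] := cont_bounded compG cP.
have kP : convol k P = (fun x => lam * P x).
  apply/funext => x; apply: (uniq (a 0 + lam)) => e e0; have [N HN] := HP _ e0.
  have h1 := convol_unif meanM ck (cv N.+1) cP (ub 0) (HN _ (leqnn N)) x.
  have h2 : `|lam * v N.+2 x - lam * P x| <= lam * e.
    rewrite -mulrBr normrM (gtr0_norm lam0) ler_wpM2l//; first exact: ltW.
    exact: HN.
  move: h1 h2; rewrite kv !ler_distl => /andP[? ?] /andP[? ?].
  by apply/andP; split; nra.
have PP : convol P P = P.
  apply/funext => x; apply: (uniq (p + (p + 1) + 1)) => e e0.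
  have [N1 HN1] := HP _ e0; have [N2 HN2] := HP _ ltr01.
  pose n := maxn N1 N2.
  have Hn y : `|v n.+1 y - P y| <= e by apply: HN1; rewrite leq_maxl.
  have vb y : `|v n.+1 y| <= p + 1.
    have := HN2 n (leq_maxr _ _) y; have := Pp y; rewrite !ler_norml => /andP[? ?] /andP[? ?].
    by apply/andP; split; lra.
  have h1 := convol_unif meanM cP (cv n.+1) cP Pp Hn x.
  have h2 := convol_unif meanM (cv n.+1) (cv n.+1) cP vb Hn x.
  have h3 : `|v (n.+1 + n.+1).+1 x - P x| <= e.
    by apply: HN1; apply: leq_trans (leq_maxl N1 N2) _; rewrite addSn -addnS leq_addr.
  move: h1 h2 h3; rewrite vv (convolC (cv n.+1) cP) !ler_distl.
  move=> /andP[? ?] /andP[? ?] /andP[? ?].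
  by apply/andP; split; nra.
exists P; split => //.
- apply/ler_addgt0Pr => e e0; have [N1 HN1] := HP _ e0; have [N2 HN2] := Hd _ ltr01.
  pose n := maxn N1 N2.
  have /andP[? _] := HN2 n.+1 (leq_trans (leq_maxr N1 N2) (leqnSn _)).
  have := HN1 n (leq_maxl N1 N2) 0; rewrite v0 /b ler_distl => /andP[? ?]; lra.
- move=> Q cQ hQ.
  have uQ n : convol (hpow h n) Q = hpow h n.
    by elim: n => // n IH; rewrite /= convolA ?IH.
  have vQ n : convol (v n) Q = v n by rewrite /v convolZl// uQ.
  have [q q0 Qq] := cont_bounded compG cQ.
  apply/funext => x; apply: (uniq (q + 1)) => e e0; have [N HN] := HP _ e0.
  have := convol_unif meanM cQ (cv N.+1) cP Qq (HN _ (leqnn N)) x.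
  have := HN _ (leqnn N) x.
  rewrite (convolC cQ (cv _)) (convolC cQ cP) vQ !ler_distl => /andP[? ?] /andP[? ?].
  by apply/andP; split; lra.
Qed.

End SpectralIdempotent.

(** * From a minimal idempotent to a character, through d'Alembert's equation *)

Section NontrivialCharacter.
Variables (R : realType) (G : topologicalZmodType).
Variable M : (G -> R) -> R.
Implicit Types f g h P Q : G -> R.
Hypothesis compG : compact [set: G].
Hypothesis hausG : hausdorff_space G.
Hypothesis meanM : is_mean M.
Hypothesis invM : forall (a : G) f, continuous f -> M (fun x => f (a + x)) = M f.

Local Notation convol := (convol M).

Let cconvol := cont_convol compG meanM.
Let convolC := convolC compG hausG meanM invM.
Let convolA := convolA compG hausG meanM invM.
Let convol_at0 := convol_at0 M.
Let convolDl := convolDl meanM.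
Let convolDr := convolDr compG hausG meanM invM.
Let sqr_eq0 := mean_sqr_eq0 compG meanM invM.

Lemma idempotent_at0 Q : even_cont Q -> convol Q Q = Q -> Q 0 = M (fun x => Q x ^+ 2).
Proof.
by move=> eQ QQ; rewrite -{1}QQ convol_at0//; under eq_fun do rewrite -expr2.
Qed.

Lemma idempotent_le Q x : even_cont Q -> convol Q Q = Q -> `|Q x| <= Q 0.
Proof.
move=> eQ QQ; rewrite idempotent_at0// -{1}QQ.
by apply: (convol_self_le compG hausG meanM invM); case: eQ.
Qed.

(** [Q 0] is the squared norm of [Q], and that is at most [Q 0 ^+ 2] because [Q] is bounded by
    [Q 0]. Morally [Q 0] is a trace, the dimension of the range of the projection; only the gap
    between 0 and 1 is needed. *)
Lemma idempotent_ge1 Q : even_cont Q -> convol Q Q = Q -> Q <> (fun=> 0) -> 1 <= Q 0.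
Proof.
move=> eQ QQ Qn0; have [cQ _] := eQ.
have Q0E := idempotent_at0 eQ QQ.
have cQ2 : continuous (fun x => Q x ^+ 2) by exact: contX.
have Q0 : 0 < Q 0.
  rewrite lt_neqAle eq_sym; apply/andP; split.
    by apply/eqP; rewrite Q0E => /(sqr_eq0 cQ).
  by rewrite Q0E; apply: mean_ge0 => // x; exact: sqr_ge0.
have : M (fun x => Q x ^+ 2) <= Q 0 ^+ 2.
  rewrite -[leRHS](mean_cst meanM); apply: mean_le => //; first exact: cont_cst.
  move=> x; rewrite -[leLHS]real_normK ?num_real// ler_sqr ?nnegrE ?normr_ge0//.
    exact: idempotent_le.
  exact: ltW.
by rewrite -Q0E expr2 ler_pMr.
Qed.

Lemma convol_shift f g a : continuous f -> continuous g ->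
  convol (fun x => f (x + a)) g = (fun x => convol f g (x + a)).
Proof.
by move=> cf cg; apply/funext => x; congr (M _); apply/funext => y; rewrite addrAC.
Qed.

Definition dalembert f := forall x a : G, f (x + a) + f (x - a) = 2 * f x * f a.

(* Descent on [P 0]: if some even [h] in the range of [P] is not a multiple of
   [P], a spectral projection of [h] or [h + P] lies strictly below [P], and
   lowers [P 0] by at least 1; a minimal [P] satisfies d'Alembert's equation. *)
Lemma idempotent_dalembert n P : even_cont P -> convol P P = P -> P <> (fun=> 0) ->
  M P = 0 -> P 0 < n.+1%:R ->
  exists f, [/\ even_cont f, f 0 = 1, M f = 0, forall x, `|f x| <= 1 & dalembert f].
Proof.
elim: n P => [|n IH] P eP PP Pn0 MP Pn; have [cP _] := eP.
  by have := idempotent_ge1 eP PP Pn0; lra.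
have [H|/existsNP[h /not_implyP[eh /not_implyP[hP hnP]]]] :=
  pselect (forall h, even_cont h -> convol h P = h -> exists c, h = (fun x => c * P x)).
  have P01 := idempotent_ge1 eP PP Pn0.
  have P00 : P 0 != 0 by rewrite gt_eqF//; lra.
  have Pinv x : P (- x) = P x by case: eP.
  exists (fun x => (P 0)^-1 * P x); split.
  - by split; [exact: contZ|move=> x; rewrite Pinv].
  - by rewrite mulVf.
  - by rewrite meanZ// MP mulr0.
  - move=> x; rewrite normrM normfV (ger0_norm (_ : 0 <= P 0)); last lra.
    by rewrite ler_pdivrMl ?mulr1 ?idempotent_le//; lra.
  - move=> x a.
    have cPa b : continuous (fun x => P (x + b)) by exact: cont_shift.
    (* The sum of the two opposite translates is even and stays in the range of [P], so minimality
       makes it a multiple of [P]; evaluation at 0 identifies the factor as [2 * P a / P 0]. *)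
    have [||c] := H (fun x => 1 * P (x + a) + P (x - a)).
    + split; first by apply: contD => //; exact: contZ.
      move=> y; rewrite !mul1r addrC -(Pinv (- y - a)) -(Pinv (- y + a)).
      by rewrite !opprD !opprK.
    + by rewrite convolDl// !convol_shift// PP.
    + move=> Hc; have := congr1 (fun k => k x) Hc; have := congr1 (fun k => k 0) Hc.
      rewrite /= !mul1r add0r sub0r Pinv => c0 cx.
      have -> : (P 0)^-1 * P (x + a) + (P 0)^-1 * P (x - a) =
        (P 0)^-1 * (P (x + a) + P (x - a)) by ring.
      rewrite cx; have -> : c = (P a + P a) / P 0 by rewrite c0; field.
      by field.
(* Only if the convolution square is a multiple of [P] can the spectral projection be [P] itself. If
   [h] squares to [c1 * P], then [h + P] squares to [(c1 + 1) * P + 2 * h], which is not a multiple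
   of [P]. *)
have [h' [eh' hP' hn']] : exists h', [/\ even_cont h', convol h' P = h' &
    ~ exists c, convol h' h' = (fun x => c * P x)].
  have [[c1 hh]|?] := pselect (exists c, convol h h = (fun x => c * P x)); last by exists h.
  exists (fun x => 1 * h x + P x); have [ch _] := eh.
  have ch1 : continuous (fun x => 1 * h x + P x) by apply: contD => //; exact: contZ.
  split; [exact: even_lin|by rewrite convolDl// hP PP|].
  move=> [c2]; rewrite convolDl// !convolDr// (convolC cP ch) hP hh PP => H.
  apply: hnP; exists ((c2 - c1 - 1) / 2); apply/funext => x.
  by have := congr1 (fun k => k x) H; rewrite /= => Hx; lra.
have [ch' _] := eh'.
have h2n0 : M (fun x => h' x ^+ 2) != 0.
  apply/eqP => /(sqr_eq0 ch') h0; apply: hn'; exists 0.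
  apply/funext => x; rewrite h0 mul0r /convol.
  under eq_fun do rewrite mul0r; exact: mean0.
have [lam lam0 [P' [eP' PP' P1 kP' HP']]] :=
  spectral_idempotent compG hausG meanM invM eh' h2n0.
have P'P := HP' P cP hP'; have [cP' _] := eP'.
(* The complementary projection is again a nonzero idempotent, so [D 0 >= 1] and
   [P' 0 <= P 0 - 1]. *)
pose D x := -1 * P' x + P x.
have eD : even_cont D by exact: even_lin.
have [cD _] := eD.
have DD : convol D D = D.
  rewrite /D convolDl// !convolDr// (convolC cP cP') PP P'P PP'.
  by apply/funext => x; ring.
have Dn0 : D <> (fun=> 0).
  move=> D0; apply: hn'; exists lam.
  have PE : P' = P.
    by apply/funext => x; have := congr1 (fun k => k x) D0; rewrite /D /=; lra.
  rewrite -PE -kP' PE convolA// hP' //.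
have D01 := idempotent_ge1 eD DD Dn0.
apply: (IH P') => //.
- by move=> P'0; move: P1; rewrite P'0 ler10.
- by rewrite -P'P mean_convol// MP mulr0.
- by move: D01; rewrite /D -natr1 in Pn *; lra.
Qed.

(** The autocorrelation of a Urysohn function minus its mean: it is even, has mean 0, and its value
    at 0 is a squared norm, nonzero since the Urysohn function is not constant. *)
Lemma mean_zero_even_function : (exists x : G, x != 0) ->
  exists h, [/\ even_cont h, M (fun x => h x ^+ 2) != 0 & M h = 0].
Proof.
move=> [x0 x0n0].
have nV : nbhs (0 : G) (~` [set x0]).
  apply: open_nbhs_nbhs; split; last by move=> /= x00; move: x0n0; rewrite -x00 eqxx.
  by apply: closed_openC; apply: accessible_closed_set1; exact: hausdorff_accessible.
have [u [cu u0 u1 uV]] := separating_function R compG hausG nV.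
have ux0 : u x0 = 0 by apply: uV => /=; apply.
pose g x := u x - M u.
have cg : continuous g by apply: contB => //; exact: cont_cst.
have Mg : M g = 0 by rewrite meanB ?mean_cst ?subrr//; exact: cont_cst.
pose r x := g (- x).
have cr : continuous r by apply: cont_comp => //; apply: contGN; exact: contG_id.
have h0 : convol g r 0 = M (fun x => g x ^+ 2).
  have cg2 : continuous (fun x => g x ^+ 2) by exact: contX.
  rewrite -(mean_inv compG hausG meanM invM cg2); congr (M _).
  by apply/funext => y; rewrite sub0r.
have eh : even_cont (convol g r).
  split; first exact: cconvol.
  move=> y; rewrite /convol.
  have cF : continuous (fun z => g (- y - z) * r z).
    by apply: contM => //; exact: cont_refl.
  rewrite -(mean_shift invM (- y) cF); congr (M _); apply/funext => z.
  by rewrite /r mulrC !opprB addKr.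
exists (convol g r); split => //; last by rewrite mean_convol// Mg mul0r.
apply/eqP => /(sqr_eq0 (proj1 eh)) H.
have : M (fun x => g x ^+ 2) = 0 by rewrite -h0 H.
move/(sqr_eq0 cg) => g0; have := congr1 (fun k => k 0) g0; have := congr1 (fun k => k x0) g0.
by rewrite /g /= u1 ux0; lra.
Qed.

Lemma dalembert_exists : (exists x : G, x != 0) ->
  exists f, [/\ even_cont f, f 0 = 1, M f = 0, forall x, `|f x| <= 1 & dalembert f].
Proof.
move=> /mean_zero_even_function[h [eh hn0 Mh]]; have [ch _] := eh.
have [lam lam0 [P [eP PP P1 kP _]]] := spectral_idempotent compG hausG meanM invM eh hn0.
have [cP _] := eP.
(* Taking means in the eigenvalue equation gives [lam * M P = M h ^ 2 * M P = 0]. Mean zero later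
   excludes the trivial solution [f = 1]. *)
have MP : M P = 0.
  have := congr1 M kP; rewrite mean_convol//; last exact: cconvol.
  rewrite mean_convol// Mh !mul0r meanZ// => /esym/eqP.
  by rewrite mulf_eq0 gt_eqF//= => /eqP.
have [n _ Pn] : exists2 n, (n > 0)%N & P 0 < n%:R.
  exists (Num.truncn (P 0)).+1 => //; exact: truncnS_gt.
apply: (@idempotent_dalembert n P) => //.
- by move=> P0; move: P1; rewrite P0 ler10.
- by apply: lt_trans Pn _; rewrite ltr_nat.
Qed.

(** For [f = cos], [f (x + a) - f x * f a] is [- sin x * sin a], and both sides are
    [sin x * sin y * sin a ^ 2]. *)
Lemma dalembert_diff f x y a : f 0 = 1 -> dalembert f ->
  (f (x + a) - f x * f a) * (f (y + a) - f y * f a) =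
  (f (x + y) - f x * f y) * (f (a + a) - f a * f a).
Proof.
move=> f0 df.
have DE u v : f (u + v) - f u * f v = (f (u + v) - f (u - v)) / 2.
  by have := df u v; lra.
have prod u v : f u * f v = (f (u + v) + f (u - v)) / 2.
  by have := df u v; lra.
have p1 : f (x + a) * f (y + a) = (f (x + y + (a + a)) + f (x - y)) / 2.
  by rewrite prod opprD addrACA [x + a + (- y - a)]addrACA subrr addr0.
have p2 : f (x + a) * f (y - a) = (f (x + y) + f (x - y + (a + a))) / 2.
  by rewrite prod opprD opprK addrACA [x + a + (- y + a)]addrACA subrr addr0.
have p3 : f (x - a) * f (y + a) = (f (x + y) + f (x - y - (a + a))) / 2.
  by rewrite prod opprD addrACA [x - a + (- y - a)]addrACA addNr addr0 opprD.
have p4 : f (x - a) * f (y - a) = (f (x + y - (a + a)) + f (x - y)) / 2.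
  by rewrite prod opprD opprK addrACA [x - a + (- y + a)]addrACA addNr addr0 opprD.
have q1 := prod (x + y) (a + a); have q2 := prod (x - y) (a + a).
rewrite !DE subrr f0; lra.
Qed.

(** The addition formula of the sine, multiplied by [- sin a]. *)
Lemma dalembert_sum f x y a : dalembert f -> (forall x, f (- x) = f x) ->
  f x * (f (y + a) - f y * f a) + f y * (f (x + a) - f x * f a) =
  f (x + y + a) - f (x + y) * f a.
Proof.
move=> df ef.
have h1 := df x (y + a); have h2 := df y (x + a); have h3 := df x y.
have h4 := df (x - y) a.
have e1 : x - (y + a) = x - y - a by rewrite opprD addrA.
have e2 : f (y - (x + a)) = f (x - y + a) by rewrite -ef opprB addrAC.
have e3 : y + (x + a) = x + y + a by rewrite addrCA addrA.
move: h1 h2; rewrite e1 e2 e3 addrA => h1 h2.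
have : f a * (f (x + y) + f (x - y)) = f a * (2 * f x * f y) by rewrite h3.
lra.
Qed.

Lemma nontrivial_character : connected [set: G] -> (exists x : G, x != 0) ->
  exists2 chi : G -> R[i], is_character chi & exists x, chi x != 1.
Proof.
move=> conG /dalembert_exists[f [[cf ef] f0 Mf f1 df]].
(* Otherwise [f] takes only the values 1 and -1; by connectedness and [f 0 = 1] it is constant 1,
   against [M f = 0]. *)
have [a fa] : exists a, f a ^+ 2 < 1.
  apply: contrapT => H.
  have f2 x : f x ^+ 2 = 1.
    apply/eqP; rewrite eq_le; apply/andP; split.
      by rewrite -[leLHS]real_normK ?num_real// expr_le1.
    by rewrite leNgt; apply/negP => Hx; apply: H; exists x.
  have fE x : f x = 1.
    have /orP[/eqP//|/eqP fx] : (f x == 1) || (f x == -1) by rewrite -sqrf_eq1 f2.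
    have ci : is_interval (f @` [set: G]).
      apply/connected_intervalP; apply: connected_continuous_connected => //.
      exact/continuous_subspaceT.
    have [y _ fy] : (f @` [set: G]) 0.
      apply: (ci (-1) 1); [by exists x|by exists 0|].
      by rewrite lerN10 ler01.
    by have := f2 y; rewrite fy expr0n => /eqP; rewrite eq_sym oner_eq0.
  have : M f = 1 by rewrite (_ : f = (fun=> 1)) ?mean_cst//; exact/funext.
  by rewrite Mf => /eqP; rewrite eq_sym oner_eq0.
pose s := Num.sqrt (1 - f a ^+ 2).
have s0 : 0 < s by rewrite sqrtr_gt0 subr_gt0.
have sn0 : s != 0 by rewrite gt_eqF.
have s2 : s ^+ 2 = 1 - f a ^+ 2 by rewrite sqr_sqrtr// subr_ge0 ltW.
have faa : f (a + a) - f a * f a = - s ^+ 2.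
  by have := df a a; rewrite subrr f0 s2; lra.
(* [s] plays the role of [|sin a|], so [D x / s] is the sine belonging to the cosine [f], up to a
   sign that amounts to conjugating the character. *)
pose D x := f (x + a) - f x * f a.
exists (fun x => (f x +i* (D x / s))%C); last first.
  have cD : continuous D.
    by apply: contB; [exact: cont_shift|apply: contM => //; exact: cont_cst].
  apply: contrapT => H.
  have fE x : f x = 1.
    have [//|Hx] := eqVneq ((f x +i* (D x / s))%C) 1; first by case.
    by exfalso; apply: H; exists x.
  have : M f = 1 by rewrite (_ : f = (fun=> 1)) ?mean_cst//; exact/funext.
  by rewrite Mf => /eqP; rewrite eq_sym oner_eq0.
split.
- move=> x y; apply/eqP; rewrite eq_complex /=; apply/andP; split; apply/eqP.
    have := dalembert_diff x y a f0 df; rewrite faa -/(D x) -/(D y) => H.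
    have -> : f (x + y) = (f x * f y * s ^+ 2 - D x * D y) / s ^+ 2.
      by rewrite H; field.
    by field.
  rewrite /D -dalembert_sum// -/(D x) -/(D y); field => //.
- move=> x; rewrite /cmod /=.
  have := dalembert_diff x x a f0 df; rewrite faa -/(D x) => H.
  have -> : f x ^+ 2 + (D x / s) ^+ 2 = 1; last exact: sqrtr1.
  have fxx := df x x; rewrite subrr f0 in fxx.
  have -> : (D x / s) ^+ 2 = (D x * D x) / s ^+ 2 by field.
  rewrite H; have -> : f (x + x) = 2 * f x * f x - 1 by lra.
  by field.
- exact: cf.
- apply: contM; last exact: cont_cst.
  by apply: contB; [exact: cont_shift|apply: contM => //; exact: cont_cst].
Qed.

End NontrivialCharacter.

(** * Characters *)

Section ComplexValued.
Variable R : realType.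
Local Notation C := R[i].

Definition sqn (z : C) : R := complex.Re z ^+ 2 + complex.Im z ^+ 2.

Lemma cReD (z w : C) : complex.Re (z + w) = complex.Re z + complex.Re w.
Proof. by case: z w => [a b] [c d]. Qed.

Lemma cImD (z w : C) : complex.Im (z + w) = complex.Im z + complex.Im w.
Proof. by case: z w => [a b] [c d]. Qed.

Lemma cReM (z w : C) :
  complex.Re (z * w) = complex.Re z * complex.Re w - complex.Im z * complex.Im w.
Proof. by case: z w => [a b] [c d]. Qed.

Lemma cImM (z w : C) :
  complex.Im (z * w) = complex.Re z * complex.Im w + complex.Im z * complex.Re w.
Proof. by case: z w => [a b] [c d]. Qed.

Lemma cRe_sum (J : Type) (s : seq J) (P : pred J) (F : J -> C) :
  complex.Re (\sum_(j <- s | P j) F j) = \sum_(j <- s | P j) complex.Re (F j).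
Proof. by elim/big_rec2: _ => // j x y _ <-; rewrite cReD. Qed.

Lemma cIm_sum (J : Type) (s : seq J) (P : pred J) (F : J -> C) :
  complex.Im (\sum_(j <- s | P j) F j) = \sum_(j <- s | P j) complex.Im (F j).
Proof. by elim/big_rec2: _ => // j x y _ <-; rewrite cImD. Qed.

Lemma sqn_ge0 z : 0 <= sqn z.
Proof. by rewrite addr_ge0 ?sqr_ge0. Qed.

Lemma sqn_conj z : sqn (z^*)%C = sqn z.
Proof. by case: z => a b; rewrite /sqn /= sqrrN. Qed.

Lemma conj_sqn (z : C) : z * (z^*)%C = (sqn z)%:C%C.
Proof.
case: z => a b; apply/eqP; rewrite eq_complex /= /sqn /=.
by apply/andP; split; apply/eqP; ring.
Qed.

Lemma cmodE (z : C) : cmod z = Num.sqrt (sqn z).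
Proof. by case: z. Qed.

Lemma cmod_ge0 (z : C) : 0 <= cmod z.
Proof. by rewrite cmodE sqrtr_ge0. Qed.

Lemma cmod_sqr (z : C) : cmod z ^+ 2 = sqn z.
Proof. by rewrite cmodE sqr_sqrtr// sqn_ge0. Qed.

Lemma cmodM (z w : C) : cmod (z * w) = cmod z * cmod w.
Proof. exact: ComplexField.Normc.normcM. Qed.

Lemma cmod_norm (z : C) : `|z| = (cmod z)%:C%C.
Proof. by []. Qed.

Lemma cmodD (z w : C) : cmod (z + w) <= cmod z + cmod w.
Proof. by have := ler_normD z w; rewrite !cmod_norm -rmorphD lecR. Qed.

Lemma cmod0 : cmod (0 : C) = 0.
Proof. exact: ComplexField.Normc.normc0. Qed.

Lemma cmod1 : cmod (1 : C) = 1.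
Proof. exact: ComplexField.Normc.normc1. Qed.

Lemma cmodN (z : C) : cmod (- z) = cmod z.
Proof. by apply: complexI; rewrite -!cmod_norm normrN. Qed.

Lemma cmod_eq0 (z : C) : (cmod z == 0) = (z == 0).
Proof.
by apply/eqP/eqP => [/ComplexField.Normc.eq0_normc//|->]; exact: cmod0.
Qed.

Lemma cmod_sum (J : Type) (s : seq J) (P : pred J) (F : J -> C) :
  cmod (\sum_(j <- s | P j) F j) <= \sum_(j <- s | P j) cmod (F j).
Proof.
elim/big_rec2: _ => [|j x y _ H]; first by rewrite cmod0.
by apply: le_trans (cmodD _ _) _; rewrite lerD2l.
Qed.

Lemma Re_le_cmod (z : C) : complex.Re z <= cmod z.
Proof.
apply: le_trans (ler_norm _) _; rewrite -ler_sqr ?nnegrE ?cmod_ge0//.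
by rewrite real_normK ?num_real// cmod_sqr lerDl sqr_ge0.
Qed.

Lemma Re_ge_cmod (z : C) : - cmod z <= complex.Re z.
Proof. by have := Re_le_cmod (- z); rewrite cmodN; case: z => a b /=; lra. Qed.

Lemma sqn_ge_Re (z : C) : complex.Re z ^+ 2 <= sqn z.
Proof. by rewrite lerDl sqr_ge0. Qed.

Lemma cmodR (r : R) : cmod (r%:C)%C = `|r|.
Proof. by rewrite cmodE /sqn /= expr0n /= addr0 sqrtr_sqr. Qed.

(** Continuity is stated on real and imaginary parts, as in [is_character], so that means of real
    functions apply directly. *)
Definition ccont (X : topologicalType) (F : X -> C) : Prop :=
  continuous (fun x => complex.Re (F x)) /\ continuous (fun x => complex.Im (F x)).

Section Ccont.
Variable X : topologicalType.
Implicit Types F H : X -> C.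

Lemma ccontM F H : ccont F -> ccont H -> ccont (fun x => F x * H x).
Proof.
move=> [? ?] [? ?]; split.
  by under eq_fun do rewrite cReM; apply: contB; exact: contM.
by under eq_fun do rewrite cImM; apply: contD; exact: contM.
Qed.

Lemma ccont_cst z : ccont (fun _ : X => z).
Proof. by split; exact: cont_cst. Qed.

Lemma ccont_conj F : ccont F -> ccont (fun x => ((F x)^*)%C).
Proof.
move=> [cr ci]; split.
  by rewrite (_ : (fun x => _) = (fun x => complex.Re (F x)))//; apply/funext => x; case: (F x).
rewrite (_ : (fun x => _) = (fun x => - complex.Im (F x))); first exact: contN.
by apply/funext => x; case: (F x).
Qed.

Lemma ccont_sum (J : Type) (s : seq J) (P : pred J) (F : J -> X -> C) :
  (forall j, ccont (F j)) -> ccont (fun x => \sum_(j <- s | P j) F j x).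
Proof.
move=> cF; split.
  by under eq_fun do rewrite cRe_sum; apply: cont_sum => j; case: (cF j).
by under eq_fun do rewrite cIm_sum; apply: cont_sum => j; case: (cF j).
Qed.

Lemma cont_sqn F : ccont F -> continuous (fun x => sqn (F x)).
Proof. by move=> [? ?]; apply: contD; exact: contX. Qed.

End Ccont.

Lemma sqn_sum (J : finType) (P : pred J) (z : J -> C) :
  sqn (\sum_(j | P j) z j) =
  \sum_(j | P j) \sum_(l | P l) complex.Re (z j * (z l)^*%C).
Proof.
rewrite /sqn cRe_sum cIm_sum !expr2 !mulr_suml -big_split/=; apply: eq_bigr => j _.
rewrite !mulr_sumr -big_split/=; apply: eq_bigr => l _.
by case: (z j) (z l) => [a b] [c d] /=; ring.
Qed.

Lemma cmod_expB1 (z : C) j : cmod z = 1 -> cmod (z ^+ j - 1) <= j%:R * cmod (z - 1).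
Proof.
move=> z1; elim: j => [|j IH]; first by rewrite expr0 subrr cmod0 mul0r.
have -> : z ^+ j.+1 - 1 = z * (z ^+ j - 1) + (z - 1) by rewrite exprS; ring.
apply: le_trans (cmodD _ _) _; rewrite cmodM z1 mul1r -natr1.
by rewrite mulrDl mul1r lerD2r.
Qed.

Lemma sqnB1 (z : C) : sqn z = 1 -> sqn (z - 1) = 2 - 2 * complex.Re z.
Proof. by case: z => a b; rewrite /sqn /= subr0 => H; lra. Qed.

End ComplexValued.

Section Characters.
Variables (R : realType) (G : topologicalZmodType).
Implicit Types chi psi : G -> R[i].

Lemma char_ccont chi : is_character chi -> ccont chi.
Proof. by case. Qed.

Lemma char_sqn chi x : is_character chi -> sqn (chi x) = 1.
Proof. by case=> _ H _ _; rewrite -cmod_sqr H expr1n. Qed.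

Lemma char_cmod chi x : is_character chi -> cmod (chi x) = 1.
Proof. by case. Qed.

Lemma char_neq0 chi x : is_character chi -> chi x != 0.
Proof. by move=> cchi; rewrite -cmod_eq0 char_cmod// oner_eq0. Qed.

Lemma charD chi x y : is_character chi -> chi (x + y) = chi x * chi y.
Proof. by case. Qed.

Lemma char0 chi : is_character chi -> chi 0 = 1.
Proof.
move=> cchi; apply: (mulfI (char_neq0 0 cchi)).
by rewrite -charD// addr0 mulr1.
Qed.

Lemma char_one : is_character (fun _ : G => 1 : R[i]).
Proof.
by split => [x y|x||]; rewrite ?mulr1 ?cmod1//; exact: cont_cst.
Qed.

Lemma char_mul chi psi : is_character chi -> is_character psi ->
  is_character (fun x => chi x * psi x).
Proof.
move=> cchi cpsi; have [? ?] := ccontM (char_ccont cchi) (char_ccont cpsi).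
split => // [x y|x]; first by rewrite !charD// mulrACA.
by rewrite cmodM !char_cmod// mulr1.
Qed.

Lemma char_conj chi : is_character chi -> is_character (fun x => ((chi x)^*)%C).
Proof.
move=> cchi; have [? ?] := ccont_conj (char_ccont cchi).
split => // [x y|x]; first by rewrite charD// rmorphM.
by rewrite cmodE sqn_conj char_sqn// sqrtr1.
Qed.

Lemma char_conjV chi x : is_character chi -> (chi x)^*%C = (chi x)^-1.
Proof.
move=> cchi; apply: (mulfI (char_neq0 x cchi)).
by rewrite conj_sqn char_sqn// divff// char_neq0.
Qed.

Lemma char_exprz chi (n : int) : is_character chi -> is_character (fun x => chi x ^ n).
Proof.
move=> cchi.
have H (m : nat) : is_character (fun x => chi x ^+ m).
  elim: m => [|m IH]; first exact: char_one.
  by under eq_fun do rewrite exprS; exact: char_mul.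
case: n => m; first exact: H.
have := char_conj (H m.+1); congr is_character; apply/funext => x.
by rewrite rmorphXn/= char_conjV// exprVn.
Qed.

Lemma char_prod (J : Type) (s : seq J) (P : pred J) (chi : J -> G -> R[i]) :
  (forall j, is_character (chi j)) -> is_character (fun x => \prod_(j <- s | P j) chi j x).
Proof.
move=> cchi; elim: s => [|j s IH].
  by under eq_fun do rewrite big_nil; exact: char_one.
by case Pj : (P j); under eq_fun do rewrite big_cons Pj; [exact: char_mul|].
Qed.

Section Orthogonality.
Variable M : (G -> R) -> R.
Hypothesis meanM : is_mean M.
Hypothesis invM : forall (a : G) (f : G -> R), continuous f -> M (fun x => f (a + x)) = M f.

(** By invariance the complex mean [z = p + i q] satisfies [z = chi a * z], and [chi a != 1] forces
    [z = 0]. *)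
Lemma char_mean0 chi : is_character chi -> (exists x, chi x != 1) ->
  M (fun x => complex.Re (chi x)) = 0.
Proof.
move=> cchi [a an1]; have [cR cI] := char_ccont cchi.
set p := M _; set q := M (fun x => complex.Im (chi x)).
have : (p +i* q)%C = chi a * (p +i* q)%C.
  apply/eqP; rewrite eq_complex cReM cImM /=; apply/andP; split; apply/eqP.
    rewrite -[LHS](invM a)// -!meanZ// -meanB//; try exact: contZ.
    by congr (M _); apply/funext => x; rewrite charD// cReM.
  rewrite -[LHS](invM a)// -!meanZ// -meanD//; try exact: contZ.
  by congr (M _); apply/funext => x; rewrite charD// cImM.
move/eqP; rewrite -subr_eq0 -{1}[(p +i* q)%C]mul1r -mulrBl mulf_eq0 subr_eq0.
by rewrite eq_sym (negbTE an1) /= eq_complex /= => /andP[/eqP].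
Qed.

Lemma char_mean chi : is_character chi ->
  M (fun x => complex.Re (chi x)) = `[< forall x, chi x = 1 >]%:R.
Proof.
move=> cchi; have [H|H] := pselect (forall x, chi x = 1).
  rewrite asboolT// (_ : (fun x => _) = (fun=> 1)) ?mean_cst//.
  by apply/funext => x; rewrite H.
rewrite asboolF// char_mean0//; apply: contrapT => H'; apply: H => x.
by apply: contrapT => /eqP Hx; apply: H'; exists x.
Qed.

End Orthogonality.

(** Among the [n]-th roots of unity 1 is isolated, whereas by connectedness the real part of a
    nontrivial character takes values arbitrarily close to 1 from below. *)
Lemma char_torsionfree chi n : connected [set: G] -> is_character chi -> (0 < n)%N ->
  (forall x, chi x ^+ n = 1) -> forall x, chi x = 1.
Proof.
move=> conG cchi n0 Hn.
have [cR cI] := char_ccont cchi.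
have nR : (1 : R) <= n%:R by rewrite ler1n.
(* The radius makes [n * |z - 1| < 1], so [1 + z + ... + z ^ (n - 1)] has positive real part; since
   [z ^ n = 1], the other factor [z - 1] must vanish. *)
have near1 y : 1 - (2 * n%:R ^+ 2)^-1 < complex.Re (chi y) -> chi y = 1.
  move=> Hy; set z := chi y in Hy *.
  have z1 : cmod z = 1 by exact: char_cmod.
  have zs : n%:R * cmod (z - 1) < 1.
    rewrite -(@ltr_pXn2r _ 2) ?nnegrE ?mulr_ge0 ?cmod_ge0// exprMn cmod_sqr.
    rewrite sqnB1 ?char_sqn// expr1n -ltr_pdivlMl ?exprn_gt0//; last lra.
    rewrite mulr1; have -> : (n%:R ^+ 2)^-1 = 2 * (2 * n%:R ^+ 2)^-1 :> R.
      by field; rewrite gt_eqF//; lra.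
    lra.
  have /eqP := Hn y; rewrite -/z -subr_eq0 subrX1 mulf_eq0 subr_eq0 => /orP[/eqP//|/eqP S0].
  have : 0 < complex.Re (\sum_(i < n) z ^+ i).
    rewrite cRe_sum; case: n n0 {S0 Hn} nR Hy zs => // m _ nR Hy zs.
    rewrite big_ord_recl /=; apply: ltr_pwDl; [exact: ltr01|apply: sumr_ge0 => i _].
    have h1 := cmod_expB1 (bump 0 i) z1.
    have h2 : (bump 0 i)%:R * cmod (z - 1) <= m.+1%:R * cmod (z - 1).
      by rewrite ler_wpM2r ?cmod_ge0// ler_nat ltnW// ltnS ltn_ord.
    have := Re_ge_cmod (z ^+ bump 0 i - 1).
    by move: (z ^+ bump 0 i) h1 => [u v] /= h1; lra.
  by rewrite S0 ltxx.
move=> x; apply: contrapT => /eqP xn1.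
have xlt1 : complex.Re (chi x) < 1.
  rewrite lt_neqAle; apply/andP; split; last by rewrite -(char_cmod x cchi) Re_le_cmod.
  apply: contra xn1 => /eqP Hx; have := char_sqn x cchi.
  case: (chi x) Hx => u v /= -> /eqP; rewrite /sqn /= expr1n addrC -subr_eq0 addrK.
  by rewrite sqrf_eq0 => /eqP ->.
have ci : is_interval ((fun x => complex.Re (chi x)) @` [set: G]).
  apply/connected_intervalP; apply: connected_continuous_connected => //.
  exact/continuous_subspaceT.
pose d : R := (2 * n%:R ^+ 2)^-1.
have d0 : 0 < d by rewrite invr_gt0 mulr_gt0// exprn_gt0//; lra.
pose t := Num.max (complex.Re (chi x)) (1 - d / 2).
have t1 : t < 1 by rewrite gt_max xlt1 /=; lra.
have [y _ Hy] : ((fun x => complex.Re (chi x)) @` [set: G]) t.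
  apply: (ci (complex.Re (chi x)) 1); [by exists x|by exists 0; rewrite ?char0|].
  by rewrite le_max lexx /= ltW.
have : chi y = 1.
  apply: near1; rewrite Hy lt_max; apply/orP; right; rewrite -/d; lra.
by move=> H; move: t1; rewrite -Hy H /= ltxx.
Qed.

End Characters.

(** * Small values of sums of characters *)

Section SmallValues.
Variables (R : realType) (G : topologicalZmodType).
Variable M : (G -> R) -> R.
Implicit Types (f u : G -> R) (chi xi : G -> R[i]).
Hypothesis compG : compact [set: G].
Hypothesis hausG : hausdorff_space G.
Hypothesis conG : connected [set: G].
Hypothesis meanM : is_mean M.
Hypothesis invM : forall (a : G) f, continuous f -> M (fun x => f (a + x)) = M f.

Lemma char_quotient1 chi xi x : is_character xi ->
  (chi x * (xi x)^*%C == 1) = (chi x == xi x).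
Proof.
move=> cxi; rewrite char_conjV//; have xi0 := char_neq0 x cxi.
by apply/eqP/eqP => [H|->]; [rewrite -[LHS](divfK xi0) H mul1r|rewrite divff].
Qed.

Definition distinct_chars (J : eqType) (e : J -> G -> R[i]) :=
  forall i j, i != j -> exists x, e i x != e j x.

Lemma mean_sqn_sum_chars (J : finType) (e : J -> G -> R[i]) :
  (forall j, is_character (e j)) -> distinct_chars e ->
  M (fun x => sqn (\sum_j e j x)) = #|J|%:R.
Proof.
move=> ce de.
have cc i j : is_character (fun x => e i x * (e j x)^*%C).
  by apply: char_mul => //; exact: char_conj.
under eq_fun do rewrite sqn_sum.
rewrite (mean_sum meanM); last first.
  by move=> i; apply: cont_sum => j; case: (char_ccont (cc i j)).
rewrite -sum1_card natr_sum; apply: eq_bigr => i _.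
rewrite (mean_sum meanM); last by move=> j; case: (char_ccont (cc i j)).
under eq_bigr => j _ do rewrite (char_mean meanM invM (cc i j)).
rewrite (bigD1 i)//= asboolT; last by move=> x; apply/eqP; rewrite char_quotient1.
rewrite big1 ?addr0// => j ji; rewrite asboolF// => H.
have [x /eqP] := de _ _ ji; apply; apply/esym/eqP.
by rewrite -char_quotient1// H.
Qed.

Lemma nontrivial_pow_distinct xi (n : nat) : is_character xi -> (exists x, xi x != 1) ->
  distinct_chars (fun (j : 'I_n) x => xi x ^+ j).
Proof.
move=> cxi [x0 x0n1] i j ij; apply: contrapT => H.
have E x : xi x ^+ i = xi x ^+ j.
  by apply: contrapT => /eqP Hx; apply: H; exists x.
wlog lij : i j ij H E / (i < j)%N.
  move=> W; have [|ji|/val_inj ijE] := ltngtP i j; first exact: W.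
    apply: (W j i) => //; first by rewrite eq_sym.
    by move=> [x]; rewrite E eqxx.
  by rewrite ijE eqxx in ij.
move/negP: x0n1; apply; apply/eqP.
apply: (char_torsionfree conG cxi (n := j - i)); first by rewrite subn_gt0.
move=> x; apply: (mulfI (expf_neq0 i (char_neq0 x cxi))).
by rewrite -exprD subnKC ?mulr1 ?E// ltnW.
Qed.

(* Fejer's kernel bounds the mass of the character [xi] near 1. *)
Lemma char_near1_majorant xi (n : nat) : is_character xi -> (exists x, xi x != 1) ->
  (0 < n)%N -> exists w : G -> R, [/\ continuous w, forall x, 0 <= w x,
    forall x, cmod (xi x - 1) < (2 * n%:R)^-1 -> 1 <= w x & M w = 4 / n%:R].
Proof.
move=> cxi xin1 n0.
have nR : (0 : R) < n%:R by rewrite ltr0n.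
have cc (j : 'I_n) : is_character (fun x => xi x ^+ j) by exact: (char_exprz (Posz j)).
have cs : continuous (fun x => sqn (\sum_(j < n) xi x ^+ j)).
  by apply: cont_sqn; apply: ccont_sum => j; exact: char_ccont.
(* Near 1 every power of [xi x] has real part at least 1/2, so the sum has squared modulus at least
   [n ^ 2 / 4]; by Parseval its mean square is [n], whence the mean [4 / n]. *)
exists (fun x => 4 / n%:R ^+ 2 * sqn (\sum_(j < n) xi x ^+ j)); split.
- exact: contZ.
- by move=> x; rewrite mulr_ge0 ?sqn_ge0// divr_ge0// exprn_ge0// ltW.
- move=> x Hx.
  have x1 := char_cmod x cxi.
  have : n%:R / 2 <= complex.Re (\sum_(j < n) xi x ^+ j).
    rewrite cRe_sum -[n in n%:R]card_ord -sum1_card natr_sum mulr_suml.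
    apply: ler_sum => j _; have h1 := cmod_expB1 j x1.
    have h2 : j%:R * cmod (xi x - 1) <= 1 / 2.
      apply: (@le_trans _ _ (n%:R * (2 * n%:R)^-1)); last first.
        by rewrite le_eqVlt; apply/orP; left; apply/eqP; field; rewrite gt_eqF.
      by apply: ler_pM; rewrite ?ler0n ?cmod_ge0 ?ler_nat//; [rewrite ltnW|exact: ltW].
    have := Re_ge_cmod (xi x ^+ j - 1).
    by move: (xi x ^+ j) h1 => [u v] /= h1; lra.
  move=> H; have := sqn_ge_Re (\sum_(j < n) xi x ^+ j).
  rewrite mulrAC ler_pdivlMr ?exprn_gt0// mul1r => /(fun h => ler_wpM2l (ler0n _ 4) h).
  apply: le_trans.
  by move: H; set r := complex.Re _ => H; nra.
- rewrite meanZ// mean_sqn_sum_chars// ?card_ord; last exact: nontrivial_pow_distinct.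
  by field; rewrite gt_eqF.
Qed.

(** Complex coefficients and a variable index set are needed because the induction multiplies
    coefficients by differences of character values and deletes indices. *)
Definition trig_sum (n : nat) (e : 'I_n -> G -> R[i]) (S : {set 'I_n})
  (c : 'I_n -> R[i]) (x : G) : R[i] := \sum_(j in S) c j * e j x.

(* The shifted combination [p (x + h) - e i h * p x] has one term less than [p]
   and is at most [2 eps] where [u x] and [u (x + h)] are both nonzero; its other
   coefficients are not too small for most [h]. *)
Lemma small_value_step n (e : 'I_n -> G -> R[i]) (S : {set 'I_n}) c m i u eps :
  (forall j, is_character (e j)) -> distinct_chars e ->
  m \in S -> i \in S -> i != m -> 1 <= cmod (c m) ->
  continuous u -> (forall x, 0 <= u x <= 1) -> 0 < M u ->
  (forall x, u x * cmod (trig_sum e S c x) <= eps) ->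
  exists (c' : 'I_n -> R[i]) (u' : G -> R), [/\ 1 <= cmod (c' m), continuous u',
    forall x, 0 <= u' x <= 1,
    M u ^+ 2 / 2 <= M u' &
    forall x, u' x * cmod (trig_sum e (S :\ i) c' x) <= 36 * eps / M u ^+ 2].
Proof.
move=> ce de mS iS im cm cu u01 Mu0 Hp.
have Mu1 : M u <= 1.
  rewrite -[leRHS](mean_cst meanM); apply: mean_le => //; first exact: cont_cst.
  by move=> x; case/andP: (u01 x).
have eps0 : 0 <= eps.
  by apply: le_trans (Hp 0); rewrite mulr_ge0 ?cmod_ge0//; case/andP: (u01 0).
set mu := M u in Mu0 Mu1 *.
have mu2 : 0 < mu ^+ 2 by rewrite exprn_gt0.
(* Chosen so that [4 / n0 < mu ^ 2 / 2]: the majorant of the bad shifts, those with [xi h] close to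
   1, then has mean less than half the mean [mu ^ 2] of [M (v h)]. *)
pose n0 := (Num.truncn (8 / mu ^+ 2)).+1.
have n0R : (0 : R) < n0%:R by rewrite ltr0n.
have n0lb : 8 / mu ^+ 2 < n0%:R by exact: truncnS_gt.
have n0ub : n0%:R <= 9 / mu ^+ 2.
  have h1 : (Num.truncn (8 / mu ^+ 2))%:R <= 8 / mu ^+ 2.
    by rewrite truncn_le// divr_ge0// ltW.
  have h2 : 1 <= 1 / mu ^+ 2 by rewrite ler_pdivlMr// mul1r expr_le1// ltW.
  rewrite /n0 -natr1; apply: le_trans (lerD h1 h2) _.
  by rewrite le_eqVlt; apply/orP; left; apply/eqP; field; rewrite gt_eqF.
pose xi h := e m h * (e i h)^*%C.
have cxi : is_character xi by apply: char_mul => //; exact: char_conj.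
have xin1 : exists h, xi h != 1.
  have [h Hh] := de _ _ im; exists h.
  by rewrite char_quotient1// eq_sym.
have [w [cw w0 w1 Mw]] := char_near1_majorant cxi xin1 (n := n0) isT.
pose v h x := u x * u (x + h).
have cv2 : continuous (fun p : G * G => v p.1 p.2).
  apply: contM; first exact: cont_on2.
  apply: cont_comp => //; apply: contGD; [exact: cont_snd|exact: cont_fst].
have cv h : continuous (v h) by apply: contM => //; exact: cont_shift.
have v01 h x : 0 <= v h x <= 1.
  have /andP[a1 a2] := u01 x; have /andP[b1 b2] := u01 (x + h).
  by rewrite mulr_ge0//= /v; nra.
have cMv : continuous (fun h => M (v h)) by exact: (cont_mean compG meanM cv2).
have MMv : M (fun h => M (v h)) = mu ^+ 2.
  rewrite (mean_fubini compG hausG meanM cv2).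
  have -> : (fun x => M (fun h => v h x)) = (fun x => mu * u x).
    apply/funext => x; rewrite /v meanZ//; last first.
      by apply: cont_comp => //; apply: contGD; [exact: contG_cst|exact: contG_id].
    by rewrite invM// mulrC.
  by rewrite meanZ// expr2.
(* If no shift were good, [M (v h)] would be at most [mu ^ 2 / 2 + w h] for every [h]; taking means
   over [h] contradicts the choice of [n0]. *)
have [h [h1 h2]] : exists h, (2 * n0%:R)^-1 <= cmod (xi h - 1) /\ mu ^+ 2 / 2 <= M (v h).
  apply: contrapT => H.
  have : mu ^+ 2 <= M (fun h => mu ^+ 2 / 2 + w h).
    rewrite -MMv; apply: mean_le => //.
      by apply: contD => //; exact: cont_cst.
    move=> h; have Mv1 : M (v h) <= 1.
      rewrite -[leRHS](mean_cst meanM); apply: mean_le => //; first exact: cont_cst.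
      by move=> x; case/andP: (v01 h x).
    have [h1|h1] := ltP (cmod (xi h - 1)) (2 * n0%:R)^-1.
      by have := w1 h h1; lra.
    have [h2|h2] := ltP (M (v h)) (mu ^+ 2 / 2); first by have := w0 h; lra.
    by exfalso; apply: H; exists h.
  rewrite meanD//; last exact: cont_cst.
  rewrite (mean_cst meanM) Mw => H1.
  have : 4 / n0%:R < mu ^+ 2 / 2.
    rewrite ltr_pdivrMr//; move: n0lb; rewrite ltr_pdivrMr// => ?; lra.
  lra.
(* The factor [2 * n0] brings the coefficient at [m] back to modulus at least 1. It costs
   [2 * n0 * (2 * eps)], at most [36 * eps / mu ^ 2] because [n0 <= 9 / mu ^ 2]. *)
exists (fun j => (2 * n0%:R)%:C%C * (c j * (e j h - e i h))), (v h); split => //.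
- rewrite !cmodM cmodR ger0_norm; last by rewrite mulr_ge0// ltW.
  have -> : cmod (e m h - e i h) = cmod (xi h - 1).
    have eih := char_neq0 h (ce i).
    have -> : e m h - e i h = e i h * (xi h - 1).
      by rewrite /xi char_conjV//; field.
    by rewrite cmodM char_cmod// mul1r.
  have : 1 <= 2 * n0%:R * cmod (xi h - 1).
    by rewrite -ler_pdivrMl ?mulr1// mulr_gt0.
  set z := cmod (xi h - 1); set y := cmod (c m) in cm * => Hz; nra.
- move=> x.
  have -> : trig_sum e (S :\ i) (fun j => (2 * n0%:R)%:C%C * (c j * (e j h - e i h))) x =
      (2 * n0%:R)%:C%C * (trig_sum e S c (x + h) - e i h * trig_sum e S c x).
    rewrite /trig_sum mulr_sumr -sumrB (big_setD1 i iS)/=.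
    have -> : c i * e i (x + h) - e i h * (c i * e i x) = 0 by rewrite charD//; ring.
    rewrite add0r mulr_sumr.
    apply: eq_bigr => j _; rewrite charD//; ring.
  rewrite cmodM cmodR ger0_norm; last by rewrite mulr_ge0// ltW.
  have hh : v h x * cmod (trig_sum e S c (x + h) - e i h * trig_sum e S c x) <= 2 * eps.
    have /andP[a1 a2] := u01 x; have /andP[b1 b2] := u01 (x + h).
    have := cmodD (trig_sum e S c (x + h)) (- (e i h * trig_sum e S c x)).
    rewrite cmodN cmodM (char_cmod h (ce i)) mul1r.
    have := Hp x; have := Hp (x + h); rewrite /v.
    have := cmod_ge0 (trig_sum e S c x); have := cmod_ge0 (trig_sum e S c (x + h)).
    set p1 := cmod (trig_sum e S c (x + h)); set p2 := cmod (trig_sum e S c x).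
    set q := cmod (_ - _) => p10 p20 H1 H2 H3.
    have k1 : u x * u (x + h) * q <= u x * u (x + h) * (p1 + p2).
      by rewrite ler_wpM2l// mulr_ge0.
    have k2 : u x * (u (x + h) * p1) <= eps.
      by apply: le_trans H1; rewrite ler_piMl// mulr_ge0.
    have k3 : u (x + h) * (u x * p2) <= eps.
      by apply: le_trans H2; rewrite ler_piMl// mulr_ge0.
    lra.
  rewrite mulrCA; apply: (@le_trans _ _ (2 * n0%:R * (2 * eps))).
    by rewrite ler_wpM2l// mulr_ge0// ltW.
  have -> : 36 * eps / mu ^+ 2 = 9 / mu ^+ 2 * (4 * eps).
    by field; rewrite gt_eqF.
  have -> : 2 * n0%:R * (2 * eps) = n0%:R * (4 * eps) by ring.
  by rewrite ler_wpM2r// mulr_ge0.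
Qed.

(** The weight [u] is a continuous substitute for the indicator function of the set where the sum is
    small. The quantifier order is essential: [a] and [A] depend on the number of terms only, not on
    the characters or the coefficients. *)
Lemma small_value_bound (k : nat) : exists a A : nat, [/\ (0 < a)%N, (0 < A)%N &
  forall n (e : 'I_n -> G -> R[i]) (S : {set 'I_n}) c m u eps,
  (forall j, is_character (e j)) -> distinct_chars e ->
  #|S| = k.+1 -> m \in S -> 1 <= cmod (c m) ->
  continuous u -> (forall x, 0 <= u x <= 1) ->
  (forall x, u x * cmod (trig_sum e S c x) <= eps) -> M u ^+ a <= A%:R * eps].
Proof.
elim: k => [|k [a [A [a0 A0 IH]]]].
  exists 1%N, 1%N; split => // n e S c m u eps ce de S1 mS cm cu u01 Hp.
  rewrite expr1 mul1r -[leRHS](mean_cst meanM); apply: mean_le => //; first exact: cont_cst.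
  move=> x; apply: le_trans (Hp x).
  have SE : S = [set m]%SET.
    by apply/esym/eqP; rewrite eqEcard finset.sub1set mS S1 cards1.
  rewrite /trig_sum SE big_set1 cmodM char_cmod// mulr1.
  by rewrite ler_peMr//; case/andP: (u01 x).
(* One step replaces [M u] by at least [M u ^ 2 / 2] and [eps] by [36 * eps / M u ^ 2]; substituting
   into the bound for [k] and clearing denominators gives these constants. *)
exists (2 * a + 2)%N, (36 * 2 ^ a * A)%N; split.
- by rewrite addn2.
- by rewrite !muln_gt0 expn_gt0 A0.
move=> n e S c m u eps ce de S1 mS cm cu u01 Hp.
have Mu_ge0 : 0 <= M u by apply: mean_ge0 => // x; case/andP: (u01 x).
have eps0 : 0 <= eps.
  by apply: le_trans (Hp 0); rewrite mulr_ge0 ?cmod_ge0//; case/andP: (u01 0).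
have [Mu0|Mun0] := eqVneq (M u) 0.
  by rewrite Mu0 expr0n addn2 /= mulr_ge0.
have Mu_gt0 : 0 < M u by rewrite lt_neqAle eq_sym Mun0.
have [i iS im] : exists2 i, i \in S & i != m.
  have : (0 < #|S :\ m|)%N by move: S1; rewrite (cardsD1 m) mS add1n => -[->].
  by case/card_gt0P => i; rewrite !inE => /andP[? ?]; exists i.
have [c' [u' [cm' cu' u01' Mu' Hp']]] :=
  small_value_step ce de mS iS im cm cu u01 Mu_gt0 Hp.
have mS' : m \in S :\ i by rewrite !inE eq_sym im.
have S1' : #|S :\ i| = k.+1 by move: S1; rewrite (cardsD1 i) iS add1n => -[].
have H := IH _ _ _ _ _ _ _ ce de S1' mS' cm' cu' u01' Hp'.
have mu2 : 0 < M u ^+ 2 by rewrite exprn_gt0.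
have H2 : (M u ^+ 2 / 2) ^+ a <= A%:R * (36 * eps / M u ^+ 2).
  by apply: le_trans H; rewrite lerXn2r// nnegrE ?divr_ge0 ?ltW//; lra.
rewrite exprD exprM -ler_pdivlMr//.
have p2 : (0 : R) < 2 ^+ a by rewrite exprn_gt0.
move: H2; rewrite expr_div_n ler_pdivrMr// => /le_trans; apply.
by rewrite !natrM natrX le_eqVlt; apply/orP; left; apply/eqP; field; rewrite gt_eqF.
Qed.

End SmallValues.

(** * Logarithmic means and moments *)

Section LogApproximation.
Variable R : realType.

Lemma is_derive_log_partial (n : nat) (x : R) :
  is_derive x 1 (fun y : R => \sum_(i < n) y ^+ i.+1 / i.+1%:R : R^o) (\sum_(i < n) x ^+ i).
Proof.
elim: n => [|n IH].
  rewrite big_ord0 (_ : (fun y => _) = cst 0); first exact: is_derive_cst.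
  by apply/funext => y; rewrite big_ord0.
rewrite big_ord_recr /=.
have -> : (fun y : R => \sum_(i < n.+1) y ^+ i.+1 / i.+1%:R : R^o) =
    (fun y : R => \sum_(i < n) y ^+ i.+1 / i.+1%:R : R^o) +
    (fun y : R => n.+1%:R^-1 *: (y ^+ n.+1 : R^o)).
  by apply/funext => y; rewrite /= big_ord_recr /= fctE; congr (_ + _); rewrite mulrC.
apply: is_deriveD.
have H : is_derive x 1 (fun y : R => y ^+ n.+1 : R^o) (n.+1%:R * x ^+ n).
  have := @is_deriveX R R^o id n.+1 x 1 1 (is_derive_id _ _).
  rewrite /= /GRing.scale /= mulr1 (_ : id ^+ n.+1 = (fun y : R => y ^+ n.+1 : R^o))//.
  by apply/funext => y; rewrite exprfctE.
have -> : x ^+ n = n.+1%:R^-1 *: (n.+1%:R * x ^+ n : R^o).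
  by rewrite /GRing.scale /= mulrA mulVf ?mul1r.
exact: is_deriveZ.
Qed.

(** The remainder vanishes at 0 and has derivative [- y ^ n / (1 - y)], so the mean value theorem
    bounds it. *)
Lemma ln_series_bound (r x : R) (n : nat) : 0 <= x -> x <= r -> r < 1 ->
  `|ln (1 - x) + \sum_(i < n) x ^+ i.+1 / i.+1%:R| <= r ^+ n / (1 - r).
Proof.
move=> x0 xr r1.
pose h (y : R) : R^o := ln (1 - y) + \sum_(i < n) y ^+ i.+1 / i.+1%:R.
have dh (y : R) : y < 1 -> is_derive y 1 h (- (y ^+ n / (1 - y))).
  move=> y1; have y10 : 0 < 1 - y by rewrite subr_gt0.
  have -> : - (y ^+ n / (1 - y)) = (1 - y)^-1 * (-1) + \sum_(i < n) y ^+ i.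
    have E : y ^+ n - 1 = (y - 1) * \sum_(i < n) y ^+ i by exact: subrX1.
    have -> : y ^+ n = 1 + (y - 1) * \sum_(i < n) y ^+ i by rewrite -E; ring.
    by field; rewrite gt_eqF.
  apply: (@is_deriveD _ _ _ (fun y : R => ln (1 - y) : R^o)).
    apply: (@is_derive1_comp R (@ln R) (fun y => 1 - y)).
      exact: is_derive1_ln.
    rewrite -[-1]add0r; apply: is_deriveB => //.
  exact: is_derive_log_partial.
have h0 : h 0 = 0.
  by rewrite /h subr0 ln1 add0r big1// => i _; rewrite expr0n /= mul0r.
have [c cI] : exists2 c, c \in `[0, x]%R & h x - h 0 = - (c ^+ n / (1 - c)) * (x - 0).
  apply: (@MVT_segment _ h (fun c => - (c ^+ n / (1 - c)))) => // [y|].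
    rewrite in_itv /= => /andP[_ yx]; apply: dh; lra.
  apply: derivable_within_continuous => y; rewrite in_itv /= => /andP[_ yx].
  by have /dh[] : y < 1 by lra.
rewrite h0 !subr0 /h => ->; move: cI; rewrite in_itv /= => /andP[c0 cx].
rewrite normrM normrN !ger0_norm//; last first.
  by rewrite divr_ge0 ?exprn_ge0//; lra.
have c1 : 0 < 1 - c by lra.
have k1 : c ^+ n <= r ^+ n by rewrite lerXn2r ?nnegrE//; lra.
have k2 : (1 - c)^-1 <= (1 - r)^-1 by rewrite lef_pV2 ?posrE//; lra.
apply: (@le_trans _ _ (c ^+ n / (1 - c) * 1)).
  by rewrite ler_wpM2l//; [rewrite divr_ge0 ?exprn_ge0//; lra|lra].
rewrite mulr1; apply: ler_pM => //; [exact: exprn_ge0|by rewrite invr_ge0 ltW].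
Qed.

(** Expanding around the right end, [u + e = (B + e) * (1 - x)] with [0 <= x <= B / (B + e) < 1], so
    one Taylor polynomial serves the whole interval. *)
Lemma log_poly_approx (B e d : R) : 0 <= B -> 0 < e -> 0 < d ->
  exists p : {poly R}, forall u, 0 <= u -> u <= B ->
    `|2^-1 * ln (u + e) - p.[u]| <= d.
Proof.
move=> B0 e0 d0.
have Be : 0 < B + e by lra.
pose r := B / (B + e).
have r0 : 0 <= r by rewrite divr_ge0// ltW.
have r1 : r < 1 by rewrite ltr_pdivrMr//; lra.
have [n Hn] : exists n, r ^+ n / (1 - r) <= d.
  have := @cvg_expr R r; rewrite ger0_norm// => /(_ r1).
  move/(@cvgrPdist_le _ R^o) => /(_ (d * (1 - r))) H.
  have /H[n _ /(_ n (leqnn n))] : 0 < d * (1 - r) by rewrite mulr_gt0// subr_gt0.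
  rewrite sub0r normrN ger0_norm ?exprn_ge0// => Hn.
  by exists n; rewrite ler_pdivrMr// subr_gt0.
pose q : {poly R} := \sum_(i < n) (i.+1%:R)^-1 *: 'X^(i.+1).
pose l : {poly R} := (B + e)^-1 *: (B%:P - 'X).
exists (2^-1 *: ((ln (B + e))%:P - (q \Po l))) => u u0 uB.
rewrite hornerZ -mulrBr normrM ger0_norm ?invr_ge0//.
apply: (@le_trans _ _ (2^-1 * d)); last by lra.
rewrite ler_wpM2l ?invr_ge0//; apply: le_trans Hn.
pose x := (B - u) / (B + e).
have x0 : 0 <= x by rewrite divr_ge0//; lra.
have xr : x <= r by rewrite ler_wpM2r// ?invr_ge0; lra.
have -> : ln (u + e) = ln (B + e) + ln (1 - x).
  rewrite -lnM ?posrE//; first by congr ln; rewrite /x; field; rewrite gt_eqF.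
  by rewrite subr_gt0; exact: le_lt_trans r1.
rewrite hornerD hornerN hornerC horner_comp.
have -> : q.[l.[u]] = \sum_(i < n) x ^+ i.+1 / i.+1%:R.
  rewrite /q horner_sum; apply: eq_bigr => i _.
  rewrite hornerZ hornerXn /l hornerZ hornerD hornerN hornerC hornerX mulrC.
  by rewrite /x (mulrC _^-1 (B - u)).
set S := \sum_(i < n) _.
have -> : ln (B + e) + ln (1 - x) - (ln (B + e) - S) = ln (1 - x) + S by ring.
exact: ln_series_bound.
Qed.

End LogApproximation.

(** * Moments of [|f|^2] and regularised logarithmic means *)

Section Moments.
Variable R : realType.

(** These are the monomials in the expansion of [|f|^(2 m)]. When the [e j] are characters each is
    again a character, so its mean only records whether it is trivial. *)
Definition cquot (X : Type) (k : nat) (e : 'I_k -> X -> R[i]) (m : nat)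
  (tau : {ffun 'I_m -> 'I_k * 'I_k}) (x : X) : R[i] :=
  \prod_(i < m) (e (tau i).1 x * (e (tau i).2 x)^*%C).

Definition real_comb (X : Type) (k : nat) (e : 'I_k -> X -> R[i]) (c : 'I_k -> R) (x : X) : R[i] :=
  \sum_(j < k) (c j)%:C%C * e j x.

Lemma real_comb_sqn_exp (X : Type) (k : nat) (e : 'I_k -> X -> R[i]) (c : 'I_k -> R) m x :
  sqn (real_comb e c x) ^+ m =
  \sum_(tau : {ffun 'I_m -> 'I_k * 'I_k})
    (\prod_(i < m) (c (tau i).1 * c (tau i).2)) * complex.Re (cquot e tau x).
Proof.
have -> : sqn (real_comb e c x) ^+ m =
    complex.Re ((real_comb e c x * (real_comb e c x)^*%C) ^+ m).
  by rewrite conj_sqn -rmorphXn.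
have -> : real_comb e c x * (real_comb e c x)^*%C =
    \sum_(q : 'I_k * 'I_k) (c q.1 * c q.2)%:C%C * (e q.1 x * (e q.2 x)^*%C).
  rewrite /real_comb rmorph_sum /= big_distrlr /= pair_bigA /=.
  apply: eq_bigr => q _; case: (e q.1 x) (e q.2 x) => [a1 b1] [a2 b2].
  by apply/eqP; rewrite eq_complex /=; apply/andP; split; apply/eqP; ring.
rewrite -[m in LHS]card_ord -prodr_const bigA_distr_bigA /= cRe_sum.
apply: eq_bigr => tau _; rewrite big_split /= -rmorph_prod /=.
by rewrite cReM /= mul0r subr0.
Qed.

Lemma real_comb_cmod_le (X : Type) (k : nat) (e : 'I_k -> X -> R[i]) (c : 'I_k -> R) x :
  (forall j, cmod (e j x) = 1) -> sqn (real_comb e c x) <= (\sum_(j < k) `|c j|) ^+ 2.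
Proof.
move=> e1; rewrite -cmod_sqr lerXn2r ?nnegrE ?cmod_ge0 ?sumr_ge0//.
apply: le_trans (cmod_sum _ _ _) _; apply: ler_sum => j _.
by rewrite cmodM cmodR e1 mulr1.
Qed.

Lemma ccont_cquot (X : topologicalType) (k : nat) (e : 'I_k -> X -> R[i]) m tau :
  (forall j, ccont (e j)) -> ccont (@cquot X k e m tau).
Proof.
move=> ce; rewrite /cquot; elim: (index_enum _) => [|i s IH].
  by under eq_fun do rewrite big_nil; exact: ccont_cst.
under eq_fun do rewrite big_cons; apply: ccontM => //.
by apply: ccontM => //; exact: ccont_conj.
Qed.

Lemma ccont_real_comb (X : topologicalType) (k : nat) (e : 'I_k -> X -> R[i]) c :
  (forall j, ccont (e j)) -> ccont (real_comb e c).
Proof. by move=> ce; apply: ccont_sum => j; apply: ccontM => //; exact: ccont_cst. Qed.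

(** A regularised Mahler measure: the logarithm of [sqrt (|f|^2 + e)] is continuous even at the
    zeros of [f]. *)
Definition log_mean (X : Type) (I : (X -> R) -> R) (f : X -> R[i]) (e : R) : R :=
  I (fun x => 2^-1 * ln (sqn (f x) + e)).

Lemma cont_log_sqn (X : topologicalType) (f : X -> R[i]) (e : R) : ccont f -> 0 < e ->
  continuous (fun x => 2^-1 * ln (sqn (f x) + e)).
Proof.
move=> cf e0; apply: contZ; apply: cont_ln => [x|]; first by rewrite ltr_wpDl// sqn_ge0.
by apply: contD; [exact: cont_sqn|exact: cont_cst].
Qed.

(* Uniform in the two function systems: only finitely many moments matter. *)
Lemma log_mean_compare (k : nat) (c : 'I_k -> R) (e d : R) : 0 < e -> 0 < d ->
  exists D : nat, forall (X1 X2 : topologicalType) (I1 : (X1 -> R) -> R)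
    (I2 : (X2 -> R) -> R) (e1 : 'I_k -> X1 -> R[i]) (e2 : 'I_k -> X2 -> R[i]),
  is_mean I1 -> is_mean I2 ->
  (forall j, ccont (e1 j)) -> (forall j, ccont (e2 j)) ->
  (forall j x, cmod (e1 j x) = 1) -> (forall j x, cmod (e2 j x) = 1) ->
  (forall m (tau : {ffun 'I_m -> 'I_k * 'I_k}), (m < D)%N ->
    I1 (fun x => complex.Re (cquot e1 tau x)) = I2 (fun x => complex.Re (cquot e2 tau x))) ->
  `|log_mean I1 (real_comb e1 c) e - log_mean I2 (real_comb e2 c) e| <= d.
Proof.
move=> e0 d0; pose B := (\sum_(j < k) `|c j|) ^+ 2.
have d20 : 0 < d / 2 by rewrite divr_gt0.
have [p Hp] := log_poly_approx (sqr_ge0 (\sum_(j < k) `|c j|)) e0 d20.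
exists (size p) => X1 X2 I1 I2 e1 e2 mI1 mI2 ce1 ce2 u1 u2 Hm.
have pE (X : topologicalType) (I : (X -> R) -> R) (e' : 'I_k -> X -> R[i]) :
    is_mean I -> (forall j, ccont (e' j)) -> (forall j x, cmod (e' j x) = 1) ->
    [/\ continuous (fun x => p.[sqn (real_comb e' c x)]),
      I (fun x => p.[sqn (real_comb e' c x)]) = \sum_(m < size p) p`_m *
         \sum_(tau : {ffun 'I_m -> 'I_k * 'I_k})
    (\prod_(i < m) (c (tau i).1 * c (tau i).2)) * I (fun x => complex.Re (cquot e' tau x)) &
      `|log_mean I (real_comb e' c) e - I (fun x => p.[sqn (real_comb e' c x)])| <= d / 2].
  move=> mI ce' u'; have cf := ccont_real_comb c ce'.
  have cs := cont_sqn cf.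
  have cp : continuous (fun x => p.[sqn (real_comb e' c x)]).
    under eq_fun do rewrite horner_coef; apply: cont_sum => m; apply: contZ; exact: contX.
  have ct m (tau : {ffun 'I_m -> 'I_k * 'I_k}) : continuous (fun x => complex.Re (cquot e' tau x)).
    by case: (ccont_cquot tau ce').
  split => //.
    under eq_fun do rewrite horner_coef.
    rewrite (mean_sum mI); last by move=> m; apply: contZ; exact: contX.
    apply: eq_bigr => m _; rewrite (meanZ mI); last exact: contX.
    congr (_ * _); under eq_fun do rewrite real_comb_sqn_exp.
    rewrite (mean_sum mI); last by move=> tau; exact: contZ.
    by apply: eq_bigr => tau _; rewrite (meanZ mI).
  apply: (mean_close mI) => //; first exact: cont_log_sqn.
  by move=> x; apply: Hp; [exact: sqn_ge0|exact: real_comb_cmod_le].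
have [_ E1 H1] := pE _ _ _ mI1 ce1 u1; have [_ E2 H2] := pE _ _ _ mI2 ce2 u2.
have E : I1 (fun x => p.[sqn (real_comb e1 c x)]) = I2 (fun x => p.[sqn (real_comb e2 c x)]).
  rewrite E1 E2; apply: eq_bigr => m _; congr (_ * _); apply: eq_bigr => tau _.
  by congr (_ * _); exact: Hm.
move: H1 H2; rewrite E !ler_norml => /andP[? ?] /andP[? ?].
by apply/andP; split; lra.
Qed.

End Moments.

(** * The uniform tail estimate for regularised logarithmic means *)

Section LogTail.
Variables (R : realType) (G : topologicalZmodType).
Variable M : (G -> R) -> R.
Hypothesis compG : compact [set: G].
Hypothesis hausG : hausdorff_space G.
Hypothesis conG : connected [set: G].
Hypothesis meanM : is_mean M.
Hypothesis invM : forall (a : G) (f : G -> R), continuous f -> M (fun x => f (a + x)) = M f.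

(** With [s = |f|^2], the gap between two regularisations is bounded and decays like [t / s]. It
    therefore lives essentially where [|f|^2] is at most of order [t], and after scaling can serve
    as the weight of the small value estimate. *)
Lemma ln_gap_bounds (s t q : R) : 0 <= s -> 0 < t -> 0 < q < 1 ->
  let d := 2^-1 * ln (s + t) - 2^-1 * ln (s + t * q) in
  [/\ 0 <= d, d <= (2 * q)^-1 & d * s <= t / 2].
Proof.
move=> s0 t0 /andP[q0 q1] d.
have tq : 0 < t * q by rewrite mulr_gt0.
have tqt : t * q <= t by rewrite ler_piMr// ltW.
have st : 0 < s + t by lra.
have stq : 0 < s + t * q by lra.
have dE : d = 2^-1 * ln ((s + t) / (s + t * q)).
  by rewrite ln_div ?posrE// mulrBr.
have d0 : 0 <= d.
  rewrite dE mulr_ge0 ?invr_ge0// ln_ge0// ler_pdivlMr// mul1r; lra.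
have dle : d <= 2^-1 * (t / (s + t * q)).
  rewrite dE ler_wpM2l ?invr_ge0//.
  have -> : (s + t) / (s + t * q) = 1 + (t - t * q) / (s + t * q).
    by field; rewrite gt_eqF.
  apply: (@le_trans _ _ ((t - t * q) / (s + t * q))).
    by apply: le_ln1Dx; rewrite (@lt_le_trans _ _ 0)// ?ltrN10// divr_ge0//; lra.
  by rewrite ler_wpM2r// ?invr_ge0; lra.
split => //.
  apply: le_trans dle _; rewrite invfM ler_wpM2l ?invr_ge0//.
  by rewrite ler_pdivrMr// -ler_pdivrMl ?invr_gt0// invrK; lra.
apply: (@le_trans _ _ (2^-1 * (t / (s + t * q)) * s)); first by rewrite ler_wpM2r.
rewrite -mulrA [t / 2]mulrC ler_wpM2l ?invr_ge0//.
by rewrite mulrAC ler_pdivrMr// ler_wpM2l; lra.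
Qed.

Lemma log_mean_tail (k : nat) : exists theta K : R, [/\ 0 < theta, theta < 1, 0 <= K &
  forall (e : 'I_k.+1 -> G -> R[i]) (c : 'I_k.+1 -> R),
  (forall j, is_character (e j)) -> distinct_chars e -> (forall j, 1 <= `|c j|) ->
  forall J i, log_mean M (real_comb e c) (theta ^+ J) -
    log_mean M (real_comb e c) (theta ^+ (J + i)) <= K * 2^-1 ^+ J].
Proof.
have [a [A [a0 A0 HA]]] := small_value_bound compG hausG conG meanM invM k.
(* The small value estimate takes an [a]-th root, so [delta = 2 ^ - a] turns [delta ^ J] into
   [2 ^ - J]; [theta = delta ^ 2] because the regularisation is added to the squared modulus. *)
pose delta : R := 2^-1 ^+ a.
have delta0 : 0 < delta by rewrite exprn_gt0// invr_gt0.
have half1 : (2^-1 : R) <= 1 by rewrite invf_le1// ler1n.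
have delta12 : delta <= 2^-1.
  case: a a0 @delta delta0 {HA} => // a _ delta _.
  by rewrite /delta exprS ler_piMr ?invr_ge0// exprn_ile1 ?invr_ge0.
pose theta := delta ^+ 2.
have theta0 : 0 < theta by rewrite exprn_gt0.
have theta4 : theta <= 4^-1 by rewrite /theta; nra.
pose B : R := (2 * theta)^-1.
have B1 : 1 <= B by rewrite /B invf_ge1 ?mulr_gt0//; lra.
have A1 : (1 : R) <= A%:R by rewrite ler1n.
exists theta, (2 * (B * A%:R)); split => //; [lra|by rewrite !mulr_ge0//; lra|].
move=> e c ce de c1.
set f := real_comb e c.
have cf : ccont f by apply: ccont_real_comb => j; exact: char_ccont.
have thn n : 0 < theta ^+ n by rewrite exprn_gt0.
have cL n := cont_log_sqn cf (thn n).
have step J : log_mean M f (theta ^+ J) - log_mean M f (theta ^+ J.+1) <= B * A%:R * 2^-1 ^+ J.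
  pose d x := 2^-1 * ln (sqn (f x) + theta ^+ J) - 2^-1 * ln (sqn (f x) + theta ^+ J.+1).
  have cd : continuous d by apply: contB; exact: cL.
  have -> : log_mean M f (theta ^+ J) - log_mean M f (theta ^+ J.+1) = M d.
    by rewrite (meanB meanM)//; exact: cL.
  have B0 : 0 < B by lra.
  pose u x := B^-1 * d x.
  have cu : continuous u by exact: contZ.
  have dB x : [/\ 0 <= d x, d x <= B & d x * sqn (f x) <= theta ^+ J / 2].
    have t1 : 0 < theta < 1 by rewrite theta0/=; lra.
    have := ln_gap_bounds (sqn_ge0 (f x)) (thn J) t1.
    by rewrite /d exprSr.
  have u01 x : 0 <= u x <= 1.
    have [d0 d1 _] := dB x; rewrite mulr_ge0 ?invr_ge0//=; last lra.
    by rewrite /u mulrC ler_pdivrMr// mul1r.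
  (* Where [|f| <= delta ^ J], [u <= 1] suffices. Elsewhere the decay gives
     [u * |f|^2 <= theta ^ J], which is at most [delta ^ J * |f|]. *)
  have uf x : u x * cmod (f x) <= delta ^+ J.
    have [d0 d1 d2] := dB x; have /andP[u0 u1] := u01 x.
    set y := cmod (f x); have y0 : 0 <= y by exact: cmod_ge0.
    have dJ : 0 < delta ^+ J by rewrite exprn_gt0.
    have [yd|yd] := leP y (delta ^+ J); first by apply: le_trans yd; rewrite ler_piMl.
    have y_gt0 : 0 < y by exact: lt_trans yd.
    rewrite -(ler_pM2r y_gt0) -mulrA -expr2 /y cmod_sqr -/y /u -mulrA.
    apply: (@le_trans _ _ (B^-1 * (theta ^+ J / 2))).
      by rewrite ler_wpM2l// invr_ge0 ltW.
    apply: (@le_trans _ _ (theta ^+ J)).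
      have := thn J; have iB : B^-1 <= 1 by rewrite invf_le1.
      have : 0 < B^-1 by rewrite invr_gt0.
      by nra.
    by rewrite /theta -exprM mulnC exprM expr2 ler_wpM2l// ltW.
  have m0 : ord0 \in [set: 'I_k.+1]%SET by rewrite inE.
  have cm : 1 <= cmod ((fun j => (c j)%:C%C) (ord0 : 'I_k.+1)) by rewrite cmodR.
  have cardT : #|[set: 'I_k.+1]%SET| = k.+1 by rewrite cardsT card_ord.
  have fE x : trig_sum e [set: 'I_k.+1]%SET (fun j => (c j)%:C%C) x = f x.
    by rewrite /trig_sum /f /real_comb; apply: eq_bigl => j; rewrite inE.
  have uf' x : u x * cmod (trig_sum e [set: 'I_k.+1]%SET (fun j => (c j)%:C%C) x) <= delta ^+ J.
    by rewrite fE.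
  have := HA _ _ _ _ _ _ _ ce de cardT m0 cm cu u01 uf'.
  have Mu0 : 0 <= M u by apply: mean_ge0 => // x; case/andP: (u01 x).
  move=> H; have : M u <= A%:R * 2^-1 ^+ J.
    have p0 : (0 : R) <= 2^-1 ^+ J by rewrite exprn_ge0 ?invr_ge0.
    rewrite -(@ler_pXn2r _ a)// ?nnegrE ?mulr_ge0//.
    apply: le_trans H _; rewrite exprMn /delta -!exprM mulnC.
    apply: ler_wpM2r; first by rewrite exprn_ge0// invr_ge0.
    by rewrite ler_eXnr.
  have -> : M d = B * M u.
    by rewrite -meanZ//; congr (M _); apply/funext => x; rewrite /u mulrA divff ?mul1r// gt_eqF.
  by rewrite -mulrA ler_pM2l.
move=> J i.
(* The bound is strengthened to the exact partial geometric sum so that it telescopes in [i]. *)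
suff : log_mean M f (theta ^+ J) - log_mean M f (theta ^+ (J + i)) <=
    2 * (B * A%:R) * (2^-1 ^+ J - 2^-1 ^+ (J + i)).
  move=> H; apply: le_trans H _; rewrite ler_wpM2l ?mulr_ge0//; first lra.
  by rewrite gerBl exprn_ge0 ?invr_ge0.
elim: i => [|i IH]; first by rewrite addn0 !subrr mulr0.
have := step (J + i)%N; rewrite addnS.
have -> : (2^-1 : R) ^+ (J + i).+1 = 2^-1 * 2^-1 ^+ (J + i) by rewrite exprS.
by move: IH; lra.
Qed.

End LogTail.

(** * Integral relations *)

Section RelationFunctional.

Lemma common_denominator (n : nat) (f : 'I_n -> rat) :
  exists (d : nat) (z : 'I_n -> int), (0 < d)%N /\ forall i, d%:R * f i = (z i)%:~R.
Proof.
exists (\prod_(i < n) `|denq (f i)|)%N,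
  (fun i => (\prod_(j < n | j != i) `|denq (f j)|)%N%:Z * numq (f i)); split.
  by apply: prodn_gt0 => i; rewrite absz_gt0 denq_neq0.
move=> i; rewrite (bigD1 i)//= natrM mulrAC mulrC rmorphM /=; congr (_ * _).
have -> : (`|denq (f i)|%N%:R : rat) = (denq (f i))%:~R.
  by rewrite -[in RHS](absz_denq (f i)).
by rewrite mulrC -{1}(divq_num_den (f i)) divfK// intr_eq0 denq_neq0.
Qed.

Lemma poly_nonroot_nat (p : {poly rat}) : p != 0 -> exists n : nat, p.[n%:R] != 0.
Proof.
move=> p0; apply: contrapT => H.
have Hr n : root p (n%:R).
  by rewrite rootE; apply/negPn/negP => Hn; apply: H; exists n.
have := @max_poly_roots _ p [seq (i%:R : rat) | i <- iota 0 (size p)] p0.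
rewrite size_map size_iota ltnn => W; suff : false by []; apply: W.
  by apply/allP => _ /mapP[i _ ->].
by rewrite map_inj_uniq ?iota_uniq// => i j /eqP; rewrite eqr_nat => /eqP.
Qed.

Local Notation toQ := (map_mx (intr : int -> rat)).

(** By saturation, a vector of [W] outside [L] is outside the rational span of [L] within [W], so
    some column of the cokernel matrix [K] detects it. Weighting the columns by powers of [t]
    combines them into one functional whose value at such a vector is a nonzero polynomial in [t]; a
    common nonroot works for all of the finite list, and denominators are cleared at the end. *)
Lemma relation_functional (k : nat) (L : 'rV[int]_k -> Prop) (W : seq 'rV[int]_k) :
  L 0 -> (forall u v, L u -> L v -> L (u + v)) -> (forall u, L u -> L (- u)) ->
  (forall n u, (0 < n)%N -> L (u *+ n) -> L u) ->
  exists N : 'I_k -> int, forall w, w \in W ->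
    (L w <-> \sum_(j < k) w 0 j * N j = 0).
Proof.
move=> L0 LD LN Lsat.
have Lnat u n : L u -> L (u *+ n).
  by move=> Lu; elim: n => [|n IH]; rewrite ?mulr0n// mulrS; exact: LD.
have LZ (z : int) u : L u -> L (z *: u).
  move=> Lu; case: z => n.
    by rewrite -natz scaler_nat; exact: Lnat.
  by rewrite NegzE scaleNr; apply: LN; rewrite -natz scaler_nat; exact: Lnat.
pose W1 := [seq w <- W | `[< L w >]].
pose A : 'M[rat]_(size W1, k) := \matrix_(i, j) ((nth 0 W1 i) 0 j)%:~R.
have rowA i : row i A = toQ (nth 0 W1 i).
  by apply/rowP => j; rewrite !mxE.
have LW1 i : L (nth 0 W1 (i : 'I_(size W1))).
  have : nth 0 W1 i \in W1 by rewrite mem_nth.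
  by rewrite mem_filter => /andP[/asboolP].
pose K := cokermx A.
have KL w : w \in W -> L w -> toQ w *m K = 0.
  move=> wW Lw; apply/eqP; rewrite -submxE.
  have wW1 : w \in W1 by rewrite mem_filter wW andbT; apply/asboolP.
  have iw : (index w W1 < size W1)%N by rewrite index_mem.
  have := row_sub (Ordinal iw) A; rewrite rowA /=.
  by rewrite nth_index.
have KnL w : ~ L w -> toQ w *m K != 0.
  move=> nLw; apply/negP; rewrite -submxE => /submxP[D wD]; apply: nLw.
  have [d [z [d0 zE]]] := common_denominator (fun i => D 0 i).
  apply: (Lsat d) => //.
  have -> : w *+ d = \sum_i z i *: nth 0 W1 (i : 'I_(size W1)).
    apply/rowP => j; apply: (@intr_inj rat).
    have -> : ((w *+ d) 0 j)%:~R = d%:R * (toQ w) 0 j :> rat.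
      by rewrite mxE mulmxnE rmorphMn /= mulr_natl.
    rewrite wD mxE mulr_sumr summxE rmorph_sum /=; apply: eq_bigr => i _.
    by rewrite !mxE rmorphM /= -zE mulrA.
  by apply: (big_ind (fun u => L u)) => // i _; apply: LZ; exact: LW1.
(* [insub] only converts an index below [k] into an ordinal; the default 0 is never reached. *)
pose pol (w : 'rV[int]_k) : {poly rat} :=
  \poly_(i < k) (if insub i is Some j then (toQ w *m K) 0 j else 0).
have polE w t : (pol w).[t] = \sum_(j < k) (toQ w *m K) 0 j * t ^+ j.
  by rewrite horner_poly; apply: eq_bigr => j _; rewrite valK.
have pol0 w : ~ L w -> pol w != 0.
  move=> /KnL; apply: contraNN => /eqP p0; apply/eqP/rowP => j.
  have := congr1 (fun p : {poly rat} => p`_j) p0; rewrite coef_poly ltn_ord valK coef0 => ->.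
  by rewrite mxE.
pose P := \prod_(w <- [seq w <- W | `[< ~ L w >]]) pol w.
have P0 : P != 0.
  rewrite prodf_seq_neq0; apply/allP => w; rewrite mem_filter => /andP[/asboolP nL _].
  exact: pol0.
have [t Pt] := poly_nonroot_nat P0.
pose v (j : 'I_k) : rat := \sum_(l < k) K j l * t%:R ^+ l.
have [d [N [d0 NE]]] := common_denominator v.
exists N => w wW.
have E : (\sum_(j < k) w 0 j * N j)%:~R = d%:R * (pol w).[t%:R] :> rat.
  rewrite rmorph_sum /= polE.
  under eq_bigr do rewrite rmorphM /= -NE mulrCA.
  rewrite -mulr_sumr; congr (_ * _).
  transitivity (\sum_(j < k) \sum_(l < k) (w 0 j)%:~R * K j l * t%:R ^+ l).
    by apply: eq_bigr => j _; rewrite mulr_sumr; apply: eq_bigr => l _; rewrite mulrA.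
  rewrite exchange_big /=; apply: eq_bigr => l _; rewrite mxE -mulr_suml.
  congr (_ * _); apply: eq_bigr => j _.
  by have -> : (toQ w) 0 j = (w 0 j)%:~R by rewrite mxE.
have dn0 : (d%:R : rat) != 0 by rewrite pnatr_eq0 -lt0n.
split=> [Lw|N0].
  apply/eqP; rewrite -(intr_eq0 rat) E polE KL// mulf_eq0 big1 ?eqxx ?orbT// => j _.
  by rewrite mxE mul0r.
apply: contrapT => nL; move/negP: Pt; apply.
have /eqP : (pol w).[t%:R] = 0.
  by apply/eqP; rewrite -(mulrI_eq0 _ (mulfI dn0)) -E N0.
rewrite /P horner_prod => pw; rewrite prodf_seq_eq0; apply/hasP.
by exists w; rewrite ?mem_filter ?wW ?andbT//; apply/asboolP.
Qed.

End RelationFunctional.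

(** * Logarithmic integrals, Haar measure and the circle *)

Section LogIntegral.
Context d (T : measurableType d) (R : realType).
Variables (mu : {measure set T -> \bar R}) (D : set T).
Hypothesis mD : measurable D.
Hypothesis muD : mu D = 1%E.
Local Open Scope ereal_scope.

(** The integral of [f] may be [-oo], so additivity is used only between nonnegative functions, in
    the form [f^+ + (K - f) = K + f^-]. *)
Lemma integral_const_sub (f : T -> \bar R) (K : R) : (0 <= K)%R ->
  measurable_fun D f -> (forall x, D x -> f x <= K%:E) ->
  \int[mu]_(x in D) (K%:E - f x) = K%:E - \int[mu]_(x in D) f x.
Proof.
move=> K0 mf fK.
have iK : \int[mu]_(x in D) (cst K%:E) x = K%:E by rewrite integral_cst// muD mule1.
have mK : measurable_fun D (cst K%:E : T -> \bar R) by exact: measurable_cst.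
have mfp : measurable_fun D f^\+ by exact: measurable_funepos.
have mfn : measurable_fun D f^\- by exact: measurable_funeneg.
have mKf : measurable_fun D (fun x => K%:E - f x) by exact: emeasurable_funB.
have ip0 : 0 <= \int[mu]_(x in D) f^\+ x by exact: integral_ge0.
have ipK : \int[mu]_(x in D) f^\+ x <= K%:E.
  rewrite -iK; apply: ge0_le_integral => // x Dx.
  by rewrite /= funeposE ge_max fK// lee_fin.
have in0 : 0 <= \int[mu]_(x in D) f^\- x by exact: integral_ge0.
have Kf0 x : D x -> 0 <= K%:E - f x.
  move=> /fK; case: (f x) => [r| |]//=; last by rewrite leey.
  by rewrite -EFinB !lee_fin subr_ge0.
have iKf0 : 0 <= \int[mu]_(x in D) (K%:E - f x) by exact: integral_ge0.
have E : \int[mu]_(x in D) f^\+ x + \int[mu]_(x in D) (K%:E - f x) =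
    K%:E + \int[mu]_(x in D) f^\- x.
  rewrite -ge0_integralD// -[X in _ = X + _]iK -ge0_integralD//.
  apply: eq_integral => x; rewrite inE => Dx.
  rewrite /= funeposE funenegE; have := fK x Dx; case: (f x) => [r| |]//=.
    move=> _; have [r0|r0] := leP r 0%R.
      by rewrite max_r ?lee_fin// max_l ?lee_fin ?oppr_ge0// add0e.
    rewrite max_l ?lee_fin ?ltW// max_r ?lee_fin ?oppr_le0 ?ltW//.
    by rewrite adde0 -!EFinD; congr EFin; lra.
  by move=> _; rewrite max_r ?leNye// add0e max_l ?leey.
rewrite [in RHS]integralE; move: ip0 ipK in0 iKf0 E.
case: (\int[mu]_(x in D) f^\+ x) => [p| |]//=.
case: (\int[mu]_(x in D) f^\- x) => [n| |]//=; case: (\int[mu]_(x in D) (K%:E - f x)) => [q| |]//=.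
by move=> _ _ _ _ /(congr1 fine) /= H; rewrite -!EFinB; congr EFin; lra.
Qed.

(** The regularised logarithms decrease to [log |F|] and are bounded above by [K], so monotone
    convergence applies to their differences from [K], whether or not the limit is finite. *)
Lemma log_integral_cvg (F : T -> R[i]) (B theta : R) : (0 < theta < 1)%R ->
  measurable_fun D (fun x => sqn (F x)) -> (forall x, D x -> (sqn (F x) <= B)%R) ->
  (fun j => (\int[mu]_(x in D) (2^-1 * ln (sqn (F x) + theta ^+ j))%:E)) @ \oo -->
  \int[mu]_(x in D) logabs (F x).
Proof.
move=> /andP[t0 t1] mF FB.
have tj j : (0 < theta ^+ j)%R by rewrite exprn_gt0.
pose K : R := (2^-1 * ln (Num.max B 0 + 1))%R.
have K0 : (0 <= K)%R.
  by rewrite mulr_ge0// ln_ge0// lerDr le_max lexx orbT.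
pose g j x : R := (2^-1 * ln (sqn (F x) + theta ^+ j))%R.
have mg j : measurable_fun D (g j).
  apply: measurable_funM; first exact: measurable_cst.
  by apply: measurableT_comp => //; apply: measurable_funD => //; exact: measurable_cst.
have pos x j : (0 < sqn (F x) + theta ^+ j)%R by rewrite ltr_wpDl// sqn_ge0.
have gK j x : D x -> (g j x <= K)%R.
  move=> Dx; rewrite ler_wpM2l ?invr_ge0// ler_ln ?posrE//; last first.
    by rewrite ltr_wpDl// le_max lexx orbT.
  by apply: lerD; [rewrite le_max FB|rewrite exprn_ile1// ltW].
have gdec x i j : (i <= j)%N -> (g j x <= g i x)%R.
  move=> ij; rewrite ler_wpM2l ?invr_ge0// ler_ln ?posrE// lerD2l.
  by rewrite ler_wiXn2l// ltW.
have tlim : (theta ^+ j)%R @[j --> \oo] --> (0 : R^o)%R.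
  by apply: cvg_expr; rewrite ger0_norm// ltW.
have glim x : (g j x)%:E @[j --> \oo] --> logabs (F x).
  rewrite /logabs; case: eqP => [Fx|/eqP Fx].
    have gE j : g j x = ((2^-1 * ln theta) * j%:R)%R.
      rewrite /g Fx /sqn /= expr0n /= addr0 add0r lnXn//.
      by rewrite mulr_natr mulrnAr.
    under eq_fun do rewrite gE.
    apply/cvgeNyPle => A; near=> j; rewrite lee_fin.
    have lt0 : (2^-1 * ln theta < 0)%R by rewrite pmulr_rlt0 ?invr_gt0// ln_lt0// t0.
    rewrite -ler_ndivrMl//; near: j; exact: nbhs_infty_ger.
  have s0 : (0 < sqn (F x))%R.
    by rewrite lt_neqAle sqn_ge0 andbT eq_sym -cmod_sqr expf_neq0// cmod_eq0.
  have -> : ln (cmod (F x)) = (2^-1 * ln (sqn (F x) + 0))%R.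
    rewrite addr0 -cmod_sqr lnXn; last by rewrite lt_neqAle cmod_ge0 eq_sym cmod_eq0 Fx.
    by rewrite -(mulr_natl (ln _)) mulrA mulVf ?mul1r// pnatr_eq0.
  apply: cvg_EFin; first by near=> j.
  apply: (@cvgMr _ _ _ _ (fun j => ln (sqn (F x) + theta ^+ j))).
  have ch : {for (0 : R)%R, continuous (fun y : R => ln (sqn (F x) + y))}.
    apply: (@continuous_comp _ _ _ (fun y : R => (sqn (F x) + y)%R : R^o) (@ln R)).
      by apply: (@cvgD _ R^o); [exact: cvg_cst|exact: cvg_id].
    by apply: continuous_ln; rewrite addr0.
  exact: (continuous_cvg _ ch tlim).
have mf : measurable_fun D (fun x => logabs (F x)).
  apply: (emeasurable_fun_cvg (fun j x => (g j x)%:E)).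
    by move=> j; apply/measurable_EFinP.
  by move=> x _; exact: glim.
have fK x : D x -> logabs (F x) <= K%:E.
  by move=> Dx; apply: (cvge_le _ (glim x)); near=> j; rewrite lee_fin gK.
have KK (y : \bar R) : K%:E - (K%:E - y) = y.
  by case: y => [r| |]//; rewrite -!EFinB; congr EFin; ring.
have defK (y : \bar R) : (K%:E +? - y) by exact: fin_num_adde_defr.
have clim : (fun j => K%:E - \int[mu]_(x in D) (g j x)%:E) @ \oo -->
    K%:E - \int[mu]_(x in D) logabs (F x).
  rewrite -integral_const_sub//.
  under eq_fun => j.
    rewrite -integral_const_sub//; last 2 first.
      by apply/measurable_EFinP.
      by move=> x Dx; rewrite lee_fin gK.
    over.
  have -> : \int[mu]_(x in D) (K%:E - logabs (F x)) =
      \int[mu]_(x in D) (limn (fun j => K%:E - (g j x)%:E)).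
    apply: eq_integral => x _; apply/esym/cvg_lim => //.
    by apply: cvgeB; [exact: defK|exact: cvg_cst|exact: glim].
  apply: cvg_monotone_convergence => //.
  - by move=> j; apply: emeasurable_funB => //; apply/measurable_EFinP.
  - by move=> j x Dx; rewrite -EFinB lee_fin subr_ge0 gK.
  - by move=> x Dx i j ij; rewrite -!EFinB lee_fin lerB// gdec.
rewrite -[X in _ --> X]KK.
rewrite (_ : (fun j => _) =
    (fun j => K%:E - (K%:E - \int[mu]_(x in D) (g j x)%:E))); last first.
  by apply/funext => j; rewrite KK.
by apply: cvgeB; [exact: defK|exact: cvg_cst|exact: clim].
Unshelve. all: by end_near. Qed.
End LogIntegral.

(** * Means defined by integrals *)

Section IntegralMean.
Context d (T : measurableType d) (R : realType) (X : topologicalType) (phi : T -> X).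
Variables (mu : {measure set T -> \bar R}) (D : set T).
Hypothesis mD : measurable D.
Hypothesis muD : mu D = 1%E.
Hypothesis contI : forall f : X -> R, continuous f ->
  mu.-integrable D (EFin \o (f \o phi)).

(** [phi] will be the identity; it only separates the measurable structure of the source from the
    topology of the target. *)
Definition integral_mean (f : X -> R) : R := (\int[mu]_(x in D) f (phi x))%R.

Lemma integral_mean_is_mean : is_mean integral_mean.
Proof.
split=> [a f g cf cg|f cf f0|].
- rewrite /integral_mean RintegralD//; last 2 first.
  + by apply: (contI (f := fun x => a * f x)); exact: contZ.
  + exact: contI.
  by rewrite RintegralZl//; exact: contI.
- by apply: Rintegral_ge0 => x _; exact: f0.
- by rewrite /integral_mean Rintegral_cst// muD mul1r.
Qed.

Lemma EFin_integral_mean (f : X -> R) : continuous f ->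
  (integral_mean f)%:E = (\int[mu]_(x in D) (f (phi x))%:E)%E.
Proof.
by move=> cf; rewrite /integral_mean /Rintegral fineK// integrable_fin_num//; exact: contI.
Qed.

Hypothesis measI : forall f : X -> R, continuous f -> measurable_fun D (f \o phi).

Lemma log_mean_cvg (F : X -> R[i]) (B theta : R) : 0 < theta < 1 -> ccont F ->
  (forall x, sqn (F x) <= B) ->
  (log_mean integral_mean F (theta ^+ j))%:E @[j --> \oo] -->
    (\int[mu]_(x in D) logabs (F (phi x)))%E.
Proof.
move=> t01 cF FB.
have := @log_integral_cvg _ _ _ mu D mD muD (F \o phi) B theta t01.
have /andP[t0 _] := t01.
have -> : (fun j => (log_mean integral_mean F (theta ^+ j))%:E) =
  (fun j => (\int[mu]_(x in D) (2^-1 * ln (sqn (F (phi x)) + theta ^+ j))%:E)%E).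
  by apply/funext => j; rewrite EFin_integral_mean//; apply: cont_log_sqn => //; exact: exprn_gt0.
apply => // [|x _]; [exact: (measI (cont_sqn cF))|exact: FB].
Qed.

End IntegralMean.

Section HaarMean.
Variables (R : realType) (G : topologicalZmodType) (mu : {measure set borelG G -> \bar R}).
Hypothesis compG : compact [set: G].
Hypothesis haar : is_haar mu.

Lemma open_borelG (A : set G) : open A -> measurable (A : set (borelG G)).
Proof. by move=> oA; apply: sub_sigma_algebra. Qed.

Lemma continuous_borelG (f : G -> R) : continuous f ->
  measurable_fun setT (f : borelG G -> R).
Proof.
move=> /continuousP cf; apply: (measurability _ (RGenOpens.measurableE R)).
move=> _ [_ [a [b ->]] <-]; rewrite setTI; apply: open_borelG.
apply: cf; exact: interval_open.
Qed.

Lemma continuous_integrableG (f : G -> R) : continuous f ->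
  mu.-integrable setT (EFin \o (f : borelG G -> R)).
Proof.
move=> cf; have [c c0 fc] := cont_bounded compG cf.
apply: measurable_bounded_integrable => //.
- by rewrite (proj1 haar) ltry.
- exact: continuous_borelG.
- exists c; split; first exact: num_real.
  by move=> c' cc' x _; apply: le_trans (fc x) (ltW cc').
Qed.

Definition haar_mean : (G -> R) -> R :=
  @integral_mean _ (borelG G) R G (fun x => x) mu setT.

Lemma haar_mean_is_mean : is_mean haar_mean.
Proof.
apply: integral_mean_is_mean => //; first exact: (proj1 haar).
exact: continuous_integrableG.
Qed.

Lemma haar_mean_invariant (a : G) (f : G -> R) : continuous f ->
  haar_mean (fun x => f (a + x)) = haar_mean f.
Proof.
move=> cf; rewrite /haar_mean /integral_mean /Rintegral; congr fine.
pose phi : borelG G -> borelG G := fun x => (a + x : G).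
have cphi : continuous (fun x : G => a + x).
  by apply: contGD; [exact: contG_cst|exact: contG_id].
have mphi : measurable_fun setT phi.
  apply: (@measurability _ _ (borelG G) (borelG G) setT phi (@open G)) => //.
  move=> _ [A oA <-]; rewrite setTI; apply: open_borelG.
  by move/continuousP : cphi; apply.
have mf : measurable_fun setT (fun x : borelG G => (f x)%:E).
  by apply/measurable_EFinP; exact: continuous_borelG.
have cfa : continuous (fun x => f (a + x)) by exact: (cont_comp cphi cf).
have := @integral_pushforward _ _ (borelG G) (borelG G) R phi mphi mu setT (fun x => (f x)%:E) mf.
rewrite preimage_setT => /(_ (continuous_integrableG cfa) measurableT) <-.
apply: eq_measure_integral => A mA _.
exact: (proj2 haar).
Qed.

End HaarMean.

Section CircleMean.
Variable R : realType.
Local Notation mu := (@lebesgue_measure R).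

(** The circle enters only through this mean on functions of a real variable and the orthogonality
    relation [circle_mean_cos]; the quotient group itself is not formed. *)
Definition circle_mean : (R -> R) -> R :=
  @integral_mean _ (measurableTypeR R) R R (fun x => x) mu `[0, 1].

Lemma lebesgue_unit : mu `[0, 1] = 1%E.
Proof. by rewrite lebesgue_measure_itv /= lte_fin ltr01 oppr0 adde0. Qed.

Lemma continuous_measurableR (f : R -> R) : continuous f ->
  measurable_fun (`[0, 1]%classic : set R) f.
Proof.
move=> cf; apply: subspace_continuous_measurable_fun; first exact: measurable_itv.
exact: continuous_subspaceT.
Qed.

Lemma continuous_integrableR (f : R -> R) : continuous f ->
  mu.-integrable `[0, 1] (EFin \o f).
Proof.
move=> cf; apply: continuous_compact_integrable; first exact: segment_compact.
exact: continuous_subspaceT.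
Qed.

Lemma circle_mean_is_mean : is_mean circle_mean.
Proof.
apply: integral_mean_is_mean => //; first exact: lebesgue_unit.
exact: continuous_integrableR.
Qed.

Lemma expiD (a b : R) : expi (a + b) = expi a * expi b.
Proof.
apply/eqP; rewrite eq_complex /= cosD sinD; apply/andP; split; apply/eqP; ring.
Qed.

Lemma expi_conj (a : R) : ((expi a)^*)%C = expi (- a).
Proof. by apply/eqP; rewrite eq_complex /= cosN sinN !eqxx. Qed.

Lemma cmod_expi (a : R) : cmod (expi a) = 1.
Proof. by rewrite /cmod /= cos2Dsin2 sqrtr1. Qed.

Lemma circle_mean_cos (n : int) :
  circle_mean (fun t => cos (2 * pi * n%:~R * t)) = (n == 0)%:R.
Proof.
case: eqP => [->|/eqP n0].
  rewrite (_ : (fun t => _) = (fun=> 1)); first exact: (mean_cst circle_mean_is_mean).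
  by apply/funext => t; rewrite mulr0 mul0r cos0.
pose w : R := 2 * pi * n%:~R.
have w0 : w != 0 by rewrite !mulf_neq0 ?intr_eq0// gt_eqF// pi_gt0.
have dF (x : R) : is_derive x 1 (fun t : R => w^-1 * sin (w * t) : R^o) (cos (w * x)).
  have h : is_derive x 1 (fun t : R => w * t : R^o) w.
    have := @is_deriveZ R R^o R^o (id : R^o -> R^o) w x 1 1 (is_derive_id _ _).
    by rewrite /GRing.scale /= mulr1.
  have := is_deriveZ (f := fun t : R => sin (w * t) : R^o) w^-1
    (is_derive1_comp (f := @sin R) (g := fun t => w * t) (is_derive_sin _) h).
  by rewrite /GRing.scale /= [cos _ * w]mulrC mulrA mulVf// mul1r.
have cF : continuous (fun t : R => w^-1 * sin (w * t) : R^o).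
  move=> x; apply: differentiable_continuous; apply/derivable1_diffP.
  by case: (dF x).
have cc : continuous (fun t : R => cos (w * t) : R).
  move=> x; apply: (@continuous_comp _ _ _ (fun t : R => w * t : R) (@cos R)).
    by apply: (@cvgM R); [exact: cvg_cst|exact: cvg_id].
  exact: continuous_cos.
have := @continuous_FTC2 R (fun t => cos (w * t)) (fun t => w^-1 * sin (w * t)) 0 1 ltr01.
move=> H; rewrite /circle_mean /integral_mean /Rintegral H.
- have -> : sin (w * 1) = 0.
    rewrite mulr1 /w.
    have sin_nat (m : nat) : sin (2 * pi * m%:R : R) = 0.
      have := periodicn (@sinD2pi R) m 0; rewrite sin0 add0r => <-.
      by congr sin; rewrite -[RHS]mulr_natr; ring.
    case: {n0 w w0 dF cF cc H} n => m; first exact: sin_nat.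
    by rewrite NegzE mulrNz mulrN sinN sin_nat oppr0.
  by rewrite !mulr0 sin0 mulr0 subee.
- exact: continuous_subspaceT.
- split.
  + by move=> x _; case: (dF x).
  + by apply: cvg_at_right_filter; exact: cF.
  + by apply: cvg_at_left_filter; exact: cF.
- by move=> x _; rewrite derive1E; case: (dF x).
Qed.

Lemma ccont_expi (n : int) : ccont (fun t : R => expi (2 * pi * n%:~R * t)).
Proof.
have cl : continuous (fun t : R => 2 * pi * n%:~R * t : R).
  by move=> x; apply: (@cvgM R); [exact: cvg_cst|exact: cvg_id].
split=> x.
  by apply: (@continuous_comp _ _ _ _ (@cos R)); [exact: cl|exact: continuous_cos].
by apply: (@continuous_comp _ _ _ _ (@sin R)); [exact: cl|exact: continuous_sin].
Qed.

Lemma cquot_expi (k m : nat) (n : 'I_k -> int) (tau : {ffun 'I_m -> 'I_k * 'I_k}) (t : R) :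
  cquot (fun j (t : R) => expi (2 * pi * (n j)%:~R * t)) tau t =
  expi (2 * pi * (\sum_(i < m) (n (tau i).1 - n (tau i).2))%:~R * t).
Proof.
rewrite /cquot; elim/big_rec2: _ => [|i x y _ ->].
  by rewrite mulr0 mul0r /expi cos0 sin0.
rewrite expi_conj -!expiD; congr expi; rewrite rmorphD rmorphB /=; ring.
Qed.

End CircleMean.

Section CharacterPowers.
Variables (R : realType) (G : topologicalZmodType).
Implicit Types chi : G -> R[i].

Lemma cquot_pow chi (k m : nat) (n : 'I_k -> int) (tau : {ffun 'I_m -> 'I_k * 'I_k}) x :
  is_character chi ->
  cquot (fun j x => chi x ^ n j) tau x = chi x ^ (\sum_(i < m) (n (tau i).1 - n (tau i).2)).
Proof.
move=> cchi; have c0 := char_neq0 x cchi.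
rewrite /cquot; elim/big_rec2: _ => [|i y z _ ->]; first by rewrite expr0z.
by rewrite (char_conjV x (char_exprz _ cchi)) !expfzDr// invr_expz.
Qed.

Lemma nontrivial_exprz chi (n : int) : connected [set: G] -> is_character chi ->
  (exists x, chi x != 1) -> (forall x, chi x ^ n = 1) <-> n = 0.
Proof.
move=> conG cchi [x0 x0n1]; split=> [H|-> x]; last by rewrite expr0z.
case: n H => [[//|n]|n] H; exfalso; move/negP: x0n1; apply; apply/eqP;
  apply: (char_torsionfree conG cchi (n := n.+1)) => // x.
by apply: invr_inj; rewrite invr1; exact: H.
Qed.

End CharacterPowers.

(** * Comparison of the two Lehmer constants *)

Section CharacterWords.
Variables (R : realType) (G : topologicalZmodType) (k : nat) (e : 'I_k -> G -> R[i]).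
Hypothesis ce : forall j, is_character (e j).

(** The homomorphism from exponent vectors to characters; its kernel is the lattice of relations
    among the [e j]. *)
Definition wchar (w : 'rV[int]_k) (x : G) : R[i] := \prod_(j < k) e j x ^ w 0 j.

(** The exponent vector of the monomial [cquot e tau]. *)
Definition qword (m : nat) (tau : {ffun 'I_m -> 'I_k * 'I_k}) : 'rV[int]_k :=
  \sum_(i < m) (delta_mx 0 (tau i).1 - delta_mx 0 (tau i).2).

Lemma char_wchar w : is_character (wchar w).
Proof.
by apply: (char_prod _ _ (chi := fun j x => e j x ^ w 0 j)) => j; exact: char_exprz.
Qed.

Lemma wchar0 x : wchar 0 x = 1.
Proof. by rewrite /wchar big1// => j _; rewrite mxE expr0z. Qed.

Lemma wcharD u v x : wchar (u + v) x = wchar u x * wchar v x.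
Proof.
rewrite /wchar -big_split /=; apply: eq_bigr => j _.
by rewrite mxE expfzDr// char_neq0.
Qed.

Lemma wcharN u x : wchar (- u) x = (wchar u x)^-1.
Proof.
apply: (mulfI (char_neq0 x (char_wchar u))).
by rewrite -wcharD subrr wchar0 divff// char_neq0//; exact: char_wchar.
Qed.

Lemma wcharMn u n x : wchar (u *+ n) x = wchar u x ^+ n.
Proof. by elim: n => [|n IH]; rewrite ?mulr0n ?wchar0// mulrS wcharD IH exprS. Qed.

Lemma wchar_delta j x : wchar (delta_mx 0 j) x = e j x.
Proof.
rewrite /wchar (bigD1 j)//= mxE !eqxx expr1z big1 ?mulr1// => i /negbTE ij.
by rewrite mxE ij andbF expr0z.
Qed.

Lemma wchar_qword m (tau : {ffun 'I_m -> 'I_k * 'I_k}) x :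
  wchar (qword tau) x = cquot e tau x.
Proof.
rewrite /qword /cquot; elim/big_rec2: _ => [|i y z _ IH]; first exact: wchar0.
by rewrite !wcharD wcharN !wchar_delta IH char_conjV.
Qed.

Lemma pairing_qword m (tau : {ffun 'I_m -> 'I_k * 'I_k}) (N : 'I_k -> int) :
  \sum_(j < k) qword tau 0 j * N j = \sum_(i < m) (N (tau i).1 - N (tau i).2).
Proof.
have pd l : \sum_(j < k) (delta_mx 0 l : 'rV[int]_k) 0 j * N j = N l.
  rewrite (bigD1 l)//= mxE !eqxx mul1r big1 ?addr0// => i /negbTE il.
  by rewrite mxE il andbF mul0r.
rewrite /qword; under eq_bigr do rewrite summxE mulr_suml.
rewrite exchange_big /=; apply: eq_bigr => i _.
rewrite -[N (tau i).1]pd -[N (tau i).2]pd -sumrB; apply: eq_bigr => j _.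
by rewrite mxE [X in (_ + X) * _]mxE mulrBl.
Qed.

Lemma character_model (D : nat) : connected [set: G] -> distinct_chars e ->
  exists N : 'I_k -> int, injective N /\
    forall m (tau : {ffun 'I_m -> 'I_k * 'I_k}), (m < D)%N ->
      (forall x, cquot e tau x = 1) <-> \sum_(i < m) (N (tau i).1 - N (tau i).2) = 0.
Proof.
move=> conG de.
(* Besides the words of length below [D], the list contains all differences of unit vectors: they
   make [N] injective, so that the powers of [chi] are distinct and the tail estimate applies to
   them. *)
pose W : seq 'rV[int]_k :=
  [seq delta_mx 0 ij.1 - delta_mx 0 ij.2 | ij <- enum {: 'I_k * 'I_k}] ++
  flatten [seq [seq qword tau | tau <- enum {: {ffun 'I_m -> 'I_k * 'I_k}}] | m <- iota 0 D].
have [||||N HN] := @relation_functional k (fun w => forall x, wchar w x = 1) W.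
- exact: wchar0.
- by move=> u v Hu Hv x; rewrite wcharD Hu Hv mulr1.
- by move=> u Hu x; rewrite wcharN Hu invr1.
- move=> n u n0 H; apply: (char_torsionfree conG (char_wchar u) n0) => x.
  by rewrite -wcharMn H.
exists N; split.
  move=> i j Nij; apply/eqP; apply: contrapT => /negP ij.
  have wW : delta_mx 0 i - delta_mx 0 j \in W.
    rewrite mem_cat; apply/orP; left; apply/mapP; exists (i, j) => //.
    by rewrite mem_enum.
  have [x /negP] := de _ _ ij; apply.
  have H : \sum_(l < k) (delta_mx 0 i - delta_mx 0 j : 'rV[int]_k) 0 l * N l = 0.
    have := pairing_qword [ffun _ : 'I_1 => (i, j)] N.
    by rewrite /qword !big_ord1 !ffunE /= Nij subrr.
  have := (HN _ wW).2 H x; rewrite wcharD wcharN !wchar_delta => E.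
  by rewrite -[e i x](divfK (char_neq0 x (ce j))) E mul1r.
move=> m tau mD.
have wW : qword tau \in W.
  rewrite mem_cat; apply/orP; right; apply/flattenP.
  exists [seq qword t | t <- enum {: {ffun 'I_m -> 'I_k * 'I_k}}].
    by apply/mapP; exists m; rewrite ?mem_iota ?add0n.
  by apply/mapP; exists tau; rewrite ?mem_enum.
have := HN _ wW; rewrite pairing_qword => <-.
by split=> H x; have := H x; rewrite wchar_qword.
Qed.

End CharacterWords.

Section LehmerConstant.
Variables (R : realType) (G : topologicalZmodType) (mu : {measure set borelG G -> \bar R}).
Hypothesis hausG : hausdorff_space G.
Hypothesis compG : compact [set: G].
Hypothesis conG : connected [set: G].
Hypothesis haar : is_haar mu.

Local Notation M := (haar_mean mu).
Let meanM := haar_mean_is_mean compG haar.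
Let invM := haar_mean_invariant compG haar.

Local Notation int_comb e c := (real_comb e (fun j => (c j)%:~R)).

Lemma mahler_cvg (k : nat) (e : 'I_k -> G -> R[i]) (c : 'I_k -> R) theta :
  0 < theta < 1 -> (forall j, is_character (e j)) ->
  (log_mean M (real_comb e c) (theta ^+ j))%:E @[j --> \oo] --> mahler mu (real_comb e c).
Proof.
move=> t01 ce.
apply: (@log_mean_cvg _ (borelG G) R G (fun x => x) mu setT measurableT (proj1 haar)
  (continuous_integrableG compG haar) _ _ ((\sum_(j < k) `|c j|) ^+ 2)) => //.
- by move=> f cf; exact: continuous_borelG.
- by apply: ccont_real_comb => j; exact: char_ccont.
- by move=> x; apply: real_comb_cmod_le => j; exact: char_cmod.
Qed.

Lemma circle_log_cvg (k : nat) (n : 'I_k -> int) (c : 'I_k -> R) theta :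
  0 < theta < 1 ->
  let F := real_comb (fun j t => expi (2 * pi * (n j)%:~R * t)) c in
  (log_mean (@circle_mean R) F (theta ^+ j))%:E @[j --> \oo] -->
    (\int[@lebesgue_measure R]_(t in `[0%R, 1%R]) logabs (F t))%E.
Proof.
move=> t01 F.
apply: (@log_mean_cvg _ (measurableTypeR R) R R (fun x => x) (@lebesgue_measure R) `[0, 1]
   (measurable_itv _) (lebesgue_unit R) (@continuous_integrableR R) _ _
   ((\sum_(j < k) `|c j|) ^+ 2)) => //.
- by move=> f cf; exact: continuous_measurableR.
- by apply: ccont_real_comb => j; exact: ccont_expi.
- by move=> x; apply: real_comb_cmod_le => j; exact: cmod_expi.
Qed.

(** All moments agree, not only finitely many, so the regularised means on [G] and on the circle are
    equal at every level, and so are their limits. *)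
Lemma mahler_pow_circle chi (k : nat) (n : 'I_k -> int) (c : 'I_k -> R) :
  is_character chi -> (exists x, chi x != 1) ->
  mahler mu (real_comb (fun j x => chi x ^ n j) c) =
  (\int[@lebesgue_measure R]_(t in `[0%R, 1%R])
     logabs (real_comb (fun j t => expi (2 * pi * (n j)%:~R * t)) c t))%E.
Proof.
move=> cchi chi1.
have cp j : is_character (fun x => chi x ^ n j) by exact: char_exprz.
have t01 : 0 < (2^-1 : R) < 1 by rewrite invr_gt0 invf_lt1//; apply/andP; split; lra.
have h1 := mahler_cvg (c := c) t01 cp; have h2 := circle_log_cvg (n := n) (c := c) t01.
suff E j : log_mean M (real_comb (fun j x => chi x ^ n j) c) (2^-1 ^+ j) =
    log_mean (@circle_mean R) (real_comb (fun j t => expi (2 * pi * (n j)%:~R * t)) c) (2^-1 ^+ j).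
  rewrite -(cvg_lim (@ereal_hausdorff R) h1) -(cvg_lim (@ereal_hausdorff R) h2).
  by congr (lim (_ @ \oo)); apply/funext => j; rewrite E.
apply/eqP; rewrite -subr_eq0 -normr_le0; apply/ler_addgt0Pr => d d0; rewrite add0r.
have ej : 0 < (2^-1 : R) ^+ j by rewrite exprn_gt0// invr_gt0.
have [D HD] := log_mean_compare c ej d0.
apply: HD.
- exact: meanM.
- exact: circle_mean_is_mean.
- by move=> i; exact: (char_ccont (cp i)).
- by move=> i; exact: ccont_expi.
- by move=> i x; exact: (char_cmod x (cp i)).
- by move=> i x; exact: cmod_expi.
move=> m tau _; set w := \sum_(i < m) (n (tau i).1 - n (tau i).2).
have -> : (fun x => complex.Re (cquot (fun j x => chi x ^ n j) tau x)) =
    (fun x => complex.Re (chi x ^ w)).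
  by apply/funext => x; rewrite cquot_pow.
rewrite (char_mean meanM invM (char_exprz w cchi)).
have -> : (fun x => complex.Re (cquot (fun j (t : R) => expi (2 * pi * (n j)%:~R * t)) tau x)) =
    (fun t => cos (2 * pi * w%:~R * t)).
  by apply/funext => x; rewrite cquot_expi.
rewrite circle_mean_cos; congr (_%:R : R); congr nat_of_bool.
by apply/asboolP/eqP => /(nontrivial_exprz w conG cchi chi1).
Qed.

Lemma log_mean_nonincr (f : G -> R[i]) (a b : R) : ccont f -> 0 < a -> a <= b ->
  log_mean M f a <= log_mean M f b.
Proof.
move=> cf a0 ab; apply: (mean_le meanM); try exact: cont_log_sqn => //.
  by apply: cont_log_sqn => //; exact: lt_le_trans ab.
move=> x; rewrite ler_wpM2l ?invr_ge0// ler_ln ?posrE ?lerD2l//.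
  by rewrite ltr_wpDl// sqn_ge0.
by rewrite ltr_wpDl ?sqn_ge0//; exact: lt_le_trans ab.
Qed.

(* Upper semicontinuity of the Mahler measure gives the upper bound; the tail
   estimate, uniform over all sums of [k.+1] characters, gives positivity. *)
Lemma approximate_by_powers chi (k : nat) (e : 'I_k.+1 -> G -> R[i])
    (c : 'I_k.+1 -> int) (r d : R) :
  is_character chi -> (exists x, chi x != 1) ->
  (forall j, is_character (e j)) -> distinct_chars e -> (forall j, c j != 0) ->
  mahler mu (int_comb e c) = r%:E -> 0 < r -> 0 < d ->
  exists N : 'I_k.+1 -> int,
    (0 < mahler mu (int_comb (fun j x => chi x ^ N j) c) <= (r + d)%:E)%E.
Proof.
move=> cchi chi1 ce de cn0 mr r0 d0.
pose cR j : R := (c j)%:~R.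
have cR1 j : 1 <= `|cR j|.
  by rewrite -intr_norm ler1z -gtz0_ge1 normr_gt0.
have [theta [K [t0 t1 K0 HK]]] := log_mean_tail compG hausG conG meanM invM k.
have t01 : 0 < theta < 1 by rewrite t0.
have tj j : 0 < theta ^+ j by rewrite exprn_gt0.
(* Three errors of size [h] occur: the regularisation of [f], the passage from [f] to [g], and the
   tail of [g]. The last one affects only the lower bound, so [m(g)] lies between [r - 3 * h > 0]
   and [r + 2 * h <= r + d]. *)
pose h := Num.min d r / 4.
have h0 : 0 < h by rewrite divr_gt0// lt_min d0.
have hd : 4 * h <= d by rewrite /h mulrC divfK ?pnatr_eq0// ge_min lexx.
have hr : 4 * h <= r by rewrite /h mulrC divfK ?pnatr_eq0// ge_min lexx orbT.
(* [J] can be fixed before [D] and [N] because [theta] and [K] depend on the number of terms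
   only. *)
have [J [HJ KJ]] : exists J, `|log_mean M (real_comb e cR) (theta ^+ J) - r| <= h /\
    K * 2^-1 ^+ J <= h.
  have := mahler_cvg (c := cR) t01 ce; rewrite mr => /fine_cvgP[_].
  move=> /(@cvgrPdist_le _ R^o) /(_ h h0) [n1 _ Hn1].
  have : (K * (2^-1 : R) ^+ j : R^o) @[j --> \oo] --> (K * 0 : R^o).
    apply: (@cvgM R); first exact: cvg_cst.
    by apply: cvg_expr; rewrite ger0_norm ?invr_ge0// invf_lt1//; lra.
  rewrite mulr0 => /(@cvgrPdist_le _ R^o) /(_ h h0) [n2 _ Hn2].
  exists (maxn n1 n2); split.
    by have := Hn1 (maxn n1 n2) (leq_maxl _ _); rewrite /= distrC.
  have := Hn2 (maxn n1 n2) (leq_maxr _ _); rewrite sub0r normrN ger0_norm//.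
  by rewrite mulr_ge0// exprn_ge0// invr_ge0.
have [D HD] := log_mean_compare cR (tj J) h0.
have [N [injN HN]] := character_model ce D conG de.
have cp j : is_character (fun x => chi x ^ N j) by exact: char_exprz.
have dp : distinct_chars (fun j x => chi x ^ N j).
  move=> i j ij; apply: contrapT => H.
  have E x : chi x ^ N i = chi x ^ N j.
    by apply: contrapT => /eqP Hx; apply: H; exists x.
  move/eqP: ij; apply; apply: injN; apply/eqP; rewrite -subr_eq0; apply/eqP.
  apply/(nontrivial_exprz _ conG cchi chi1) => x.
  by rewrite expfzDr ?char_neq0// E -expfzDr ?char_neq0// subrr expr0z.
exists N; set g := real_comb _ _.
have cg : ccont g by apply: ccont_real_comb => j; exact: char_ccont.
have cmp : `|log_mean M (real_comb e cR) (theta ^+ J) - log_mean M g (theta ^+ J)| <= h.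
  apply: HD.
  - exact: meanM.
  - exact: meanM.
  - by move=> i; exact: char_ccont.
  - by move=> i; exact: (char_ccont (cp i)).
  - by move=> i x; exact: char_cmod.
  - by move=> i x; exact: (char_cmod x (cp i)).
  move=> m tau mD; have ct : is_character (cquot e tau).
    have -> : cquot e tau = wchar e (qword tau).
      by apply/funext => x; rewrite wchar_qword.
    exact: char_wchar.
  set w := \sum_(i < m) (N (tau i).1 - N (tau i).2).
  have -> : (fun x => complex.Re (cquot (fun j x => chi x ^ N j) tau x)) =
      (fun x => complex.Re (chi x ^ w)).
    by apply/funext => x; rewrite cquot_pow.
  rewrite (char_mean meanM invM ct) (char_mean meanM invM (char_exprz w cchi)).
  congr (_%:R : R); congr nat_of_bool; apply/asboolP/asboolP.
    by move/(HN _ _ mD)/(nontrivial_exprz w conG cchi chi1).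
  by move/(nontrivial_exprz w conG cchi chi1)/(HN _ _ mD).
have gcvg := mahler_cvg (c := cR) t01 cp.
move: HJ cmp; rewrite !ler_norml => /andP[a1 a2] /andP[b1 b2].
apply/andP; split.
  apply: (@lt_le_trans _ _ (log_mean M g (theta ^+ J) - h)%:E).
    by rewrite lte_fin; lra.
  apply: (cvge_ge _ gcvg); exists J => // j /= Jj.
  rewrite lee_fin; have := HK _ _ cp dp cR1 J (j - J)%N; rewrite subnKC// -/g => ?; lra.
apply: (@le_trans _ _ (log_mean M g (theta ^+ J))%:E); last by rewrite lee_fin; lra.
apply: (cvge_le _ gcvg); exists J => // j /= Jj; rewrite lee_fin.
by apply: log_mean_nonincr => //; rewrite ler_wiXn2l// ltW.
Qed.

(** Equal characters are collected and vanishing coefficients dropped, since the tail estimate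
    requires distinct characters and coefficients of modulus at least 1. *)
Lemma zlin_eval_reduced (s : seq (int * (G -> R[i]))) :
  (forall p, p \in s -> is_character p.2) ->
  exists (k : nat) (e : 'I_k -> G -> R[i]) (c : 'I_k -> int),
    [/\ forall j, is_character (e j), distinct_chars e, forall j, c j != 0 &
      zlin_eval s = int_comb e c].
Proof.
move=> cs.
pose U := undup (map snd s).
pose coef (u : G -> R[i]) : int := \sum_(p <- s | p.2 == u) p.1.
pose V := [seq u <- U | coef u != 0].
exists (size V), (fun j => tnth (in_tuple V) j), (fun j => coef (tnth (in_tuple V) j)).
have VP j : tnth (in_tuple V) j \in V by exact: mem_tnth.
have uV : uniq V by rewrite filter_uniq// undup_uniq.
split.
- move=> j; have := VP j; rewrite mem_filter mem_undup => /andP[_ /mapP[p ps ->]].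
  exact: cs.
- move=> i j ij; apply: contrapT => H.
  have E : tnth (in_tuple V) i = tnth (in_tuple V) j.
    by apply/funext => x; apply: contrapT => /eqP Hx; apply: H; exists x.
  by move/eqP: ij; apply; exact: (elimT (tuple_uniqP (in_tuple V)) uV _ _ E).
- by move=> j; have := VP j; rewrite mem_filter => /andP[].
apply/funext => x; rewrite /real_comb.
transitivity (\sum_(u <- V) ((coef u)%:~R : R[i]) * u x); last first.
  by rewrite big_tnth; apply: eq_bigr => j _; rewrite rmorph_int.
rewrite big_filter /zlin_eval.
transitivity (\sum_(u <- U) ((coef u)%:~R : R[i]) * u x); last first.
  rewrite [RHS]big_mkcond /=; apply: eq_bigr => u _.
  by case: eqP => //= ->; rewrite mul0r.
under [RHS]eq_bigr do rewrite rmorph_sum /= mulr_suml big_mkcond /=.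
rewrite exchange_big /=; apply: eq_big_seq => p ps.
rewrite -big_mkcond /=; under eq_bigl do rewrite eq_sym.
rewrite -big_filter filter_pred1_uniq ?big_seq1 ?undup_uniq// mem_undup.
by apply/mapP; exists p.
Qed.

End LehmerConstant.

Lemma laurent_eval_comb (R : realType) (s : seq (int * int)) (t : R) :
  laurent_eval s t = real_comb
    (fun (j : 'I_(size s)) t => expi (2 * pi * ((tnth (in_tuple s) j).2)%:~R * t))
    (fun j => ((tnth (in_tuple s) j).1)%:~R) t.
Proof.
rewrite /laurent_eval /real_comb big_tnth; apply: eq_bigr => j _.
by rewrite rmorph_int.
Qed.

Lemma zlin_eval_pow_comb (R : realType) (G : topologicalZmodType) (chi : G -> R[i])
    (s : seq (int * int)) :
  zlin_eval [seq (p.1, (fun x => chi x ^ p.2)) | p <- s] = real_comb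
    (fun (j : 'I_(size s)) x => chi x ^ (tnth (in_tuple s) j).2)
    (fun j => ((tnth (in_tuple s) j).1)%:~R).
Proof.
apply/funext => x; rewrite /zlin_eval /real_comb big_map big_tnth.
by apply: eq_bigr => j _; rewrite rmorph_int.
Qed.

Section Comparison.
Variables (R : realType) (G : topologicalZmodType) (mu : {measure set borelG G -> \bar R}).
Variable chi : G -> R[i].
Hypothesis hausG : hausdorff_space G.
Hypothesis compG : compact [set: G].
Hypothesis conG : connected [set: G].
Hypothesis haar : is_haar mu.
Hypothesis cchi : is_character chi.
Hypothesis chi1 : exists x, chi x != 1.

Lemma mahler_laurent (s : seq (int * int)) :
  mahler mu (zlin_eval [seq (p.1, (fun x => chi x ^ p.2)) | p <- s]) = mahlerT R s.
Proof.
rewrite zlin_eval_pow_comb (mahler_pow_circle compG conG haar _ _ cchi chi1).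
by apply: eq_integral => t _; rewrite laurent_eval_comb.
Qed.

Lemma lehmer_le_circle : (lehmer mu <= lehmerT R)%E.
Proof.
apply: ereal_inf_le_tmp => _ [s [-> s0]].
exists (zlin_eval [seq (p.1, (fun x => chi x ^ p.2)) | p <- s]).
  exists [seq (p.1, (fun x => chi x ^ p.2)) | p <- s]; split => // _ /mapP[p _ ->].
  exact: char_exprz.
by rewrite mahler_laurent.
Qed.

Lemma circle_le_lehmer : (lehmerT R <= lehmer mu)%E.
Proof.
apply/ereal_infP => _ [_ [s [cs ->]] [-> m0]].
have [k [e [c [ce de cn0 E]]]] := zlin_eval_reduced cs.
move: m0; rewrite E; clear E; case: k e c ce de cn0 => [|k] e c ce de cn0.
  (* The empty sum is the zero function, whose Mahler measure [-oo] contradicts positivity. *)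
  rewrite (_ : mahler mu _ = -oo%E)// /mahler.
  under eq_integral do rewrite /real_comb big_ord0 /logabs eqxx.
  by rewrite integral_cst ?(proj1 haar) ?mule1.
move mE : (mahler mu _) => m; case: m mE => [r| |]// mE; last by rewrite leey.
rewrite lte_fin => r0; apply/lee_addgt0Pr => d d0.
have [N /andP[N0 Nd]] :=
  approximate_by_powers hausG compG conG haar cchi chi1 ce de cn0 mE r0 d0.
apply: (le_trans _ Nd).
pose s' := [seq (c j, N j) | j <- enum 'I_k.+1].
have sE : mahler mu (real_comb (fun j x => chi x ^ N j) (fun j => (c j)%:~R)) = mahlerT R s'.
  rewrite -mahler_laurent; congr (mahler mu _); apply/funext => x.
  rewrite /zlin_eval -map_comp big_map /real_comb big_enum /=.
  by apply: eq_bigr => j _; rewrite rmorph_int.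
rewrite sE; apply: ereal_inf_lbound; exists s'; split => //.
by rewrite -sE.
Qed.

End Comparison.

Theorem theorem3p2 (R : realType) (G : topologicalZmodType)
  (mu : {measure set borelG G -> \bar R}) :
  hausdorff_space G -> compact [set: G] -> connected [set: G] ->
  (exists x : G, x != 0) -> is_haar mu ->
  lehmer mu = lehmerT R.
Proof.
move=> hausG compG conG nontriv haar.
have [chi cchi chi1] := nontrivial_character compG hausG
  (haar_mean_is_mean compG haar) (haar_mean_invariant compG haar) conG nontriv.
apply/eqP; rewrite eq_le; apply/andP; split.
  exact: lehmer_le_circle compG conG haar cchi chi1.
exact: circle_le_lehmer hausG compG conG haar cchi chi1.
Qed.
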